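(* Let $G$ be an infinite pseudocompact Boolean topological group. Assume that at least one of the following holds: (i) $|G|\le 2^{2^{\mathfrak{c}}}$; (ii) the Singular Cardinal Hypothesis SCH holds. Then the (abstract) group $G$ admits a pseudocompact reflexive group topology which is not selectively pseudocompact.
   Context: All topological groups and group topologies are assumed to be Hausdorff. $\mathfrak{c}$ denotes the cardinality of the continuum. A group $G$ is Boolean if $x^2=e$ for every $x\in G$, where $e$ is the identity element (every Boolean group is abelian). A space is pseudocompact if every continuous real-valued function on it is bounded. A group topology $\tau$ on $G$ is said to have one of the properties below if the topological group $(G,\tau)$ has it. SCH is the standard set-theoretic statement: for every singular cardinal $\kappa$, if $2^{\mathrm{cf}(\kappa)}<\kappa$ then $\kappa^{\mathrm{cf}(\kappa)}=\kappa^+$. For an abelian topological group $G$, its Pontryagin dual $G^\wedge$ is the group of all continuous group homomorphisms from $G$ to the circle group $\mathbb{T}$, endowed with the compact-open topology; $G^{\wedge\wedge}=(G^\wedge)^\wedge$. For $g\in G$ let $\psi_g\in G^{\wedge\wedge}$ be given by $\psi_g(h)=h(g)$ for $h\in G^\wedge$, and let $\alpha_G:G\to G^{\wedge\wedge}$ be the map $\alpha_G(g)=\psi_g$. The group $G$ is (Pontryagin) reflexive if $\alpha_G$ is a topological isomorphism between $G$ and $G^{\wedge\wedge}$. A point $x$ of a topological space $X$ is an accumulation point of a sequence $\{x_n:n\in\mathbb{N}\}$ of points of $X$ if the set $\{n\in\mathbb{N}: x_n\in V\}$ is infinite for every neighbourhood $V$ of $x$ in $X$. A topological space $X$ is selectively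 pseudocompact if for every sequence $\{U_n:n\in\mathbb{N}\}$ of non-empty open subsets of $X$ one can choose $x_n\in U_n$ for every $n\in\mathbb{N}$ such that the sequence $\{x_n:n\in\mathbb{N}\}$ has an accumulation point in $X$. *)

(* Defs.v *)
From HB Require Import structures.
From mathcomp Require Import all_boot all_order all_algebra.
From mathcomp Require Import all_classical all_reals all_analysis.
From mathcomp Require wochoice.
From mathcomp.real_closed Require Import complex.

Set Implicit Arguments.
Unset Strict Implicit.
Unset Printing Implicit Defensive.

Import Order.TTheory GRing.Theory Num.Theory.
Import numFieldNormedType.Exports.

Local Open Scope classical_set_scope.
Local Open Scope ring_scope.
Local Open Scope complex_scope.
Local Open Scope card_scope.

Definition card_lt (T U : Type) (A : set T) (B : set U) : Prop :=
  (A #<= B) /\ ~ (B #<= A).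
Notation "A '#<' B" := (card_lt A B) (at level 79) : card_scope.

(* Below, a type K stands for the cardinal |[set: K]|. *)

(* Proper initial segments are smaller than K: (K, r) has the order type of *)
(* the initial ordinal of its cardinality. *)
Definition initial_well_order (K : Type) (r : rel K) : Prop :=
  wochoice.well_order r /\
  forall x : K, [set y | r y x /\ y <> x] #< [set: K].

Definition cofinal_in (K : Type) (r : rel K) (A : set K) : Prop :=
  forall x : K, exists2 y : K, A y & r x y.

(* cf(|K|) = |L| *)
Definition is_cofinality (K L : Type) : Prop :=
  exists r : rel K,
    [/\ initial_well_order r,
        exists2 A : set K, cofinal_in r A & (A #= [set: L])
      & forall A : set K, cofinal_in r A -> [set: L] #<= A].

(* |M| = |K|^+ *)
Definition is_successor_card (K M : Type) : Prop :=
  ([set: K] #< [set: M]) /\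
  forall N : Type, ([set: K] #< [set: N]) -> [set: M] #<= [set: N].

Definition SCH : Prop :=
  forall K L : Type,
    infinite_set [set: K] -> is_cofinality K L -> ([set: L] #< [set: K]) ->
    ([set: set L] #< [set: K]) -> is_successor_card K (L -> K).

Definition pseudocompact (R : realType) (X : topologicalType) : Prop :=
  forall f : X -> R, continuous f -> bounded_fun f.

Definition accumulation_point (X : topologicalType) (x_ : nat -> X) (x : X) :
    Prop :=
  forall V : set X, nbhs x V -> infinite_set [set n | V (x_ n)].

Definition selectively_pseudocompact (X : topologicalType) : Prop :=
  forall U : nat -> set X, (forall n, open (U n) /\ U n !=set0) ->
    exists2 x_ : nat -> X, (forall n, U n (x_ n)) &
      exists x : X, accumulation_point x_ x.

(* Not necessarily Hausdorff. *)
Record group_topology (G : zmodType) := GroupTopology {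
  gt_open : set_system G;
  gt_openT : gt_open setT;
  gt_openI : setI_closed gt_open;
  gt_open_bigU : forall (I : Type) (f : I -> set G),
    (forall i, gt_open (f i)) -> gt_open (\bigcup_i f i);
  gt_sub_continuous : forall (x y : G) (O : set G), gt_open O -> O (x - y) ->
    exists A B : set G, [/\ gt_open A, gt_open B, A x, B y &
      forall a b, A a -> B b -> O (a - b)]
}.

(* G retopologized by tau *)
Definition with_topology (G : zmodType) (tau : group_topology G) : Type := G.

Section with_topology.
Variables (G : zmodType) (tau : group_topology G).
Local Notation H := (with_topology tau).

HB.instance Definition _ := GRing.Zmodule.on H.
HB.instance Definition _ := @isOpenTopological.Build H (gt_open tau)
  (gt_openT tau) (@gt_openI _ tau) (@gt_open_bigU _ tau).

Lemma with_topology_openE (A : set H) : open A = gt_open tau A.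
Proof. by []. Qed.

Lemma with_topology_sub_continuous :
  continuous (fun x : H * H => x.1 - x.2).
Proof.
move=> [x y] V; rewrite nbhsE => -[W [oW Wxy] WV].
have [A [B [oA oB Ax By AB]]] := gt_sub_continuous oW Wxy.
exists (A, B) => /=.
  by split; apply: open_nbhs_nbhs; split.
by move=> [a b] [/= Aa Bb]; apply: WV; exact: AB.
Qed.

HB.instance Definition _ := PreTopologicalNmodule_isTopologicalZmodule.Build H
  with_topology_sub_continuous.

End with_topology.

(* The unit circle of the complex plane under multiplication; as abelian *)
(* groups are additive in the library, + on circle is the complex product. *)
Record circle (R : realType) := Circle {
  circle_val :> R[i];
  circle_norm : `|circle_val| == 1
}.

Section circle.
Variable R : realType.
Local Notation T := (circle R).

HB.instance Definition _ := [isSub for @circle_val R].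
HB.instance Definition _ := [Choice of T by <:].

Fact circle1_subproof : `|1 : R[i]| == 1.
Proof. by rewrite normr1. Qed.

Fact circleM_subproof (x y : T) : `|(x : R[i]) * y| == 1.
Proof.
by rewrite normrM (eqP (circle_norm x)) (eqP (circle_norm y)) mulr1.
Qed.

Fact circleV_subproof (x : T) : `|(x : R[i])^-1| == 1.
Proof. by rewrite normfV (eqP (circle_norm x)) invr1. Qed.

Definition circle1 : T := Circle circle1_subproof.
Definition circleM (x y : T) : T := Circle (circleM_subproof x y).
Definition circleV (x : T) : T := Circle (circleV_subproof x).

Lemma circle_neq0 (x : T) : (x : R[i]) != 0.
Proof. by rewrite -normr_eq0 (eqP (circle_norm x)) oner_eq0. Qed.

Fact circleMA : associative circleM.
Proof. by move=> x y z; apply: val_inj; rewrite /= mulrA. Qed.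

Fact circleMC : commutative circleM.
Proof. by move=> x y; apply: val_inj; rewrite /= mulrC. Qed.

Fact circle1M : left_id circle1 circleM.
Proof. by move=> x; apply: val_inj; rewrite /= mul1r. Qed.

Fact circleVM : left_inverse circle1 circleV circleM.
Proof. by move=> x; apply: val_inj; rewrite /= mulVf ?circle_neq0. Qed.

HB.instance Definition _ :=
  GRing.isZmodule.Build T circleMA circleMC circle1M circleVM.

HB.instance Definition _ := Topological.copy T
  (initial_topology (fun x : T => (circle_val x : R[i]^o))).

Lemma circle_val_continuous : continuous (fun x : T => (circle_val x : R[i]^o)).
Proof. exact: initial_continuous. Qed.

Lemma circle_sub_continuous : continuous (fun x : T * T => x.1 - x.2).
Proof.
apply: continuous_comp_initial => -[x y].
have c1 : continuous (fun u : T * T => (circle_val u.1 : R[i]^o)).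
  by move=> u; apply: continuous_comp; [exact: cvg_fst|exact: initial_continuous].
have c2 : continuous (fun u : T * T => (circle_val u.2 : R[i]^o)).
  by move=> u; apply: continuous_comp; [exact: cvg_snd|exact: initial_continuous].
have cM := @cvgM R[i] _ (nbhs (x, y)) _
  (fun u : T * T => (circle_val u.1 : R[i]^o))
  (fun u : T * T => ((circle_val u.2)^-1 : R[i]^o)) _ _ (c1 (x, y)).
by apply: cM; apply: cvgV; [exact: circle_neq0|exact: c2].
Qed.

HB.instance Definition _ :=
  PreTopologicalNmodule_isTopologicalZmodule.Build T circle_sub_continuous.

End circle.

Section pontryagin_dual.
Variables (R : realType) (G : PreTopologicalZmodule.type).

Definition is_character : {pred G -> circle R} :=
  fun f => `[< continuous f /\ {morph f : x y / x + y} >].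

Fact is_character_zmod_closed : zmod_closed is_character.
Proof.
split=> [|f g /asboolP[cf af] /asboolP[cg ag]]; apply/asboolP; split.
- by move=> x; exact: cvg_cst.
- by move=> x y; rewrite /= addr0.
- move=> x; apply: (@continuous_comp _ _ _ (fun x => (f x, g x))
    (fun u : circle R * circle R => u.1 - u.2)).
    exact: (cvg_pair (cf x) (cg x)).
  exact: sub_continuous.
- by move=> x y; rewrite /= !fctE af ag opprD addrACA.
Qed.

HB.instance Definition _ :=
  GRing.isZmodClosed.Build (G -> circle R) is_character is_character_zmod_closed.

(* Continuous homomorphisms G -> T under pointwise addition, with the *)
(* compact-open topology. *)
Record pontryagin_dual := Character {
  character_fun :> G -> circle R;
  character_funP : character_fun \in is_character
}.

HB.instance Definition _ := [isSub for character_fun].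
HB.instance Definition _ := [Choice of pontryagin_dual by <:].
HB.instance Definition _ := [SubChoice_isSubZmodule of pontryagin_dual by <:].
HB.instance Definition _ := Topological.copy pontryagin_dual
  (initial_topology (character_fun : pontryagin_dual ->
                     {compact-open, G -> circle R})).

End pontryagin_dual.
Arguments pontryagin_dual : clear implicits.

Definition topological_isomorphism (A B : PreTopologicalZmodule.type)
    (f : A -> B) : Prop :=
  {morph f : x y / x + y} /\
  exists f' : B -> A, [/\ cancel f f', cancel f' f, continuous f & continuous f'].

Section reflexive.
Variables (R : realType) (G : PreTopologicalZmodule.type).
Local Notation dual := (pontryagin_dual R).

Fact bidual_map_subproof (g : G) :
  (fun h : dual G => h g) \in @is_character R (dual G).
Proof.
apply/asboolP; split=> // h U; rewrite nbhsE => -[W [oW Whg] WU].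
have oS : open ([set k | k @` [set g] `<=` W] : set {compact-open, G -> circle R}).
  by apply: compact_open_open => //; exact: compact_set1.
have : nbhs h [set k : dual G | character_fun k @` [set g] `<=` W].
  apply: open_nbhs_nbhs; split; first by exists [set k | k @` [set g] `<=` W].
  by move=> _ [_ -> <-].
by apply: filterS => k kW; apply: WU; apply: kW; exists g.
Qed.

(* alpha_G *)
Definition bidual_map (g : G) : dual (dual G) :=
  Character (bidual_map_subproof g).

Definition pontryagin_reflexive : Prop := topological_isomorphism bidual_map.

End reflexive.

(* Main.v *)
(* If an infinite cardinal t satisfies t^w <= |G| <= 2^(2^t), there are homomorphisms
   chi_j : G -> Z/2 (j in J) which interpolate in both directions: arbitrary values at
   countably many j are taken at some g in G, and every homomorphism G -> Z/2 agrees on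
   any countable subset of G with some chi_j. For the topology induced by the chi_j, the
   first property yields pseudocompactness. By the second one, linearly independent
   sequences do not accumulate, so that compact sets are finite and selections from the
   open sets {chi_n = 1, chi_m = 0 for m < n} have no accumulation point. The dual is
   then the span of the chi_j with the topology of pointwise convergence, and the same
   argument with both properties exchanged shows that G is reflexive.

   For t one can take c if |G| <= 2^(2^c), as infinite pseudocompact groups have at least
   c elements. Otherwise let t be the least cardinal with 2^t > |G|. Unless some 2^m with
   m < t is suitable, t is a strong limit. If cf(t) > w then t^w = t. If cf(t) = w then
   t < |G|, since by the Baire property and precompactness a pseudocompact group with at
   least t elements is not the union of countably many sets of size < t; and then
   t^w = t^+ <= |G| by SCH. *)
Require Import Defs.
From HB Require Import structures.
From mathcomp Require Import all_boot all_order all_algebra.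
From mathcomp Require Import all_classical all_reals all_analysis.
From mathcomp.real_closed Require Import complex.

Import Order.TTheory GRing.Theory Num.Theory.
Import numFieldNormedType.Exports.

Local Open Scope classical_set_scope.
Local Open Scope ring_scope.
Local Open Scope card_scope.

Set Implicit Arguments.
Unset Strict Implicit.
Unset Printing Implicit Defensive.

(** * Cardinal arithmetic *)

(** Cardinals are compared through types throughout, sets entering by coercion to subtypes, so that
    products and function spaces can be formed freely. *)
Definition inj_le (T U : Type) : Prop := exists f : T -> U, injective f.
Local Notation "T '<~' U" := (inj_le T U) (at level 70).

Lemma card_le_injP (T U : Type) (A : set T) (B : set U) : A #<= B <-> A <~ B.
Proof.
split=> [/card_leP[f]|[f fi]].
  by exists f => x y; apply: inj; rewrite inE.
by apply/card_leP/injfunPex; exists f => // x y _ _; exact: fi.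
Qed.

Lemma inj_leP (T U : Type) : [set: T] #<= [set: U] <-> T <~ U.
Proof.
rewrite card_le_injP; split=> -[f fi].
  exists (fun x => val (f (SigSub (mem_setT x)))) => x y /val_inj/fi.
  by move=> /(congr1 val).
by exists (fun x => SigSub (mem_setT (f (val x)))) => x y /(congr1 val)/fi/val_inj.
Qed.

Lemma inj_le_refl (T : Type) : T <~ T.
Proof. by exists id. Qed.

Lemma inj_le_trans (U T V : Type) : T <~ U -> U <~ V -> T <~ V.
Proof. by move=> [f fi] [g gi]; exists (g \o f); exact: inj_comp. Qed.

Lemma inj_le_surj (T U : Type) (f : U -> T) :
  (forall y, exists x, f x = y) -> T <~ U.
Proof.
move=> /choice[g gK]; exists g => x y gxy.
by rewrite -(gK x) gxy gK.
Qed.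

Lemma surj_inj_le (T U : Type) (t0 : T) :
  T <~ U -> exists (f : U -> T), forall y, exists x, f x = y.
Proof.
move=> [g gi].
have [f fP] : {f : U -> T & forall u, forall t, g t = u -> f u = t}.
  apply: (@choice _ _ (fun u t' => forall t, g t = u -> t' = t)) => u.
  have [[t gt]|nt] := pselect (exists t, g t = u).
    by exists t => t' ; rewrite -gt => /gi.
  by exists t0 => t gt; case: nt; exists t.
by exists f => y; exists (g y); exact: fP.
Qed.

Lemma inj_le_prod (T T' U U' : Type) : T <~ T' -> U <~ U' ->
  (T * U)%type <~ (T' * U')%type.
Proof.
move=> [f fi] [g gi]; exists (fun p => (f p.1, g p.2)).
by move=> -[a b] [c d] /= [/fi -> /gi ->].
Qed.

Lemma inj_le_codom (A T U : Type) : T <~ U -> (A -> T) <~ (A -> U).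
Proof.
move=> [f fi]; exists (fun g => f \o g) => g h e; apply/funext => a.
by apply: fi; exact: (congr1 (fun k => k a) e).
Qed.

Lemma inj_le_dom (A T U : Type) (a0 : A) : T <~ U -> (T -> A) <~ (U -> A).
Proof.
move=> TU; have [[t0 _]|nT] := pselect (exists t : T, True); last first.
  (* If [T] is empty, there is only one function on [T], and any map is injective. *)
  exists (fun _ _ => a0) => f g _; apply/funext => t; by case: nT; exists t.
have [f fs] := surj_inj_le t0 TU.
exists (fun g => g \o f) => g h e; apply/funext => t; have [u <-] := fs t.
exact: (congr1 (fun k => k u) e).
Qed.

Lemma inj_le_curry (A B C : Type) : (A -> B -> C) <~ (A * B -> C).
Proof.
exists (fun f p => f p.1 p.2) => f g e; apply/funext => a; apply/funext => b.
exact: (congr1 (fun k => k (a, b)) e).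
Qed.

Lemma inj_le_singleton (T : Type) : T <~ (T -> bool).
Proof.
exists (fun x y => `[< x = y >]) => x y e.
have /= := congr1 (fun k => k y) e; rewrite [RHS]asboolT // => xy.
by apply/asboolP; rewrite xy.
Qed.

Lemma inj_le_bool_set (T : Type) : (T -> bool) <~ (set T).
Proof.
exists (fun f x => f x = true) => f g e; apply/funext => x.
have exy : (f x = true) = (g x = true) := congr1 (fun k => k x) e.
by apply/idP/idP; rewrite /is_true exy.
Qed.

Lemma inj_le_set_bool (T : Type) : (set T) <~ (T -> bool).
Proof.
exists (fun A x => `[< A x >]) => A B e; apply/seteqP; split=> x Ax.
  by apply/asboolP; rewrite -(congr1 (fun k => k x) e); exact/asboolP.
by apply/asboolP; rewrite (congr1 (fun k => k x) e); exact/asboolP.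
Qed.

Lemma inj_le_set_type (T : Type) (A : set T) : A <~ T.
Proof. by exists val; exact: val_inj. Qed.

Lemma cantor_inj_le (T : Type) : ~ (T -> bool) <~ T.
Proof.
move=> /(surj_inj_le (fun=> true))[f fs].
have [x e] := fs (fun x => ~~ f x x).
by have := congr1 (fun k => k x) e => /=; case: (f x x).
Qed.

Lemma inj_le_nat2 : (nat * nat)%type <~ nat.
Proof. by apply/inj_leP; have /card_eqPle[] := card_nat2. Qed.

Lemma infinite_inj_le (T : Type) : infinite_set [set: T] <-> nat <~ T.
Proof. by rewrite infiniteP inj_leP. Qed.

Lemma inj_le_total (T U : Type) : T <~ U \/ U <~ T.
Proof.
pose P (F : set (T * U)) := (forall x y y', F (x, y) -> F (x, y') -> y = y') /\
  (forall x x' y, F (x, y) -> F (x', y) -> x = x').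
have [F [[Ff Fi] Fmax]] : exists A, P A /\ forall B, A `<` B -> ~ P B.
  apply: Zorn_bigcup => C CP Ctot; split.
    move=> x y y' [A CA Axy] [B CB Bxy]; have [AB|BA] := Ctot _ _ CA CB.
      exact: (CP _ CB).1 (AB _ Axy) Bxy.
    exact: (CP _ CA).1 Axy (BA _ Bxy).
  move=> x x' y [A CA Axy] [B CB Bxy]; have [AB|BA] := Ctot _ _ CA CB.
    exact: (CP _ CB).2 (AB _ Axy) Bxy.
  exact: (CP _ CA).2 Axy (BA _ Bxy).
have [/choice[f fF]|] := pselect (forall x, exists y, F (x, y)).
  by left; exists f => x y e; apply: Fi (fF x) _; rewrite e.
move=> /existsNP[x0 /forallNP x0F].
have [/choice[f fF]|] := pselect (forall y, exists x, F (x, y)).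
  by right; exists f => x y e; apply: Ff (fF x) _; rewrite e.
move=> /existsNP[y0 /forallNP y0F].
exfalso; apply: (Fmax (F `|` [set (x0, y0)])).
  split; first by move=> p Fp; left.
  by move=> /(_ (x0, y0) (or_intror erefl)) /x0F.
split=> [x y y'|x x' y].
  move=> [Fxy|[ex ey]] [Fxy'|[ex' ey']].
  - exact: Ff Fxy Fxy'.
  - by case: (x0F y); rewrite -ex'.
  - by case: (x0F y'); rewrite -ex.
  - by rewrite ey.
move=> [Fxy|[ex ey]] [Fxy'|[ex' ey']].
- exact: Fi Fxy Fxy'.
- by case: (y0F x); rewrite -ey'.
- by case: (y0F x'); rewrite -ey.
- by rewrite ex.
Qed.

(* Graphs F of injections A * A -> A with A a subset of T, which is recovered from
   F as square_graph F. *)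
Definition square_graph (T : Type) (F : set (T * T * T)) : set T :=
  [set x | exists z, F ((x, x), z)].

Definition squaring (T : Type) (F : set (T * T * T)) : Prop :=
  [/\ forall p z z', F (p, z) -> F (p, z') -> z = z',
      forall p p' z, F (p, z) -> F (p', z) -> p = p',
      forall x y z, F ((x, y), z) ->
        [/\ square_graph F x, square_graph F y & square_graph F z]
    & forall x y, square_graph F x -> square_graph F y ->
        exists z, F ((x, y), z)].

Lemma squaring_bigcup (T : Type) (C : set (set (T * T * T))) :
  (forall F, C F -> squaring F) -> total_on C subset ->
  squaring (\bigcup_(F in C) F).
Proof.
move=> CP Ctot.
have sub F x : C F -> square_graph F x -> square_graph (\bigcup_(F in C) F) x.
  by move=> CF [z Fz]; exists z, F.
have two F F' : C F -> C F' -> exists2 F'', C F'' & F `<=` F'' /\ F' `<=` F''.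
  by move=> CF CF'; have [?|?] := Ctot _ _ CF CF';
    [exists F' => //; split | exists F => //; split].
split.
- move=> p z z' [F CF Fz] [F' CF' Fz']; have [F'' CF'' [s s']] := two _ _ CF CF'.
  by have [f _ _ _] := CP _ CF''; exact: f (s _ Fz) (s' _ Fz').
- move=> p p' z [F CF Fz] [F' CF' Fz']; have [F'' CF'' [s s']] := two _ _ CF CF'.
  by have [_ i _ _] := CP _ CF''; exact: i (s _ Fz) (s' _ Fz').
- move=> x y z [F CF Fz]; have [_ _ c _] := CP _ CF.
  have [xF yF zF] := c _ _ _ Fz.
  by split; [exact: sub CF xF|exact: sub CF yF|exact: sub CF zF].
- move=> x y [z [F CF Fz]] [z' [F' CF' Fz']].
  have [F'' CF'' [s s']] := two _ _ CF CF'.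
  have [_ _ _ t] := CP _ CF''; have [||w Fw] := t x y.
  + by exists z; exact: s.
  + by exists z'; exact: s'.
  by exists w, F''.
Qed.

Lemma squaring_inj_le (T : Type) (F : set (T * T * T)) :
  squaring F -> (square_graph F * square_graph F)%type <~ square_graph F.
Proof.
move=> [Ff Fi Fc Ft].
have /choice[f fF] : forall p : square_graph F * square_graph F,
    exists z : square_graph F, F ((val p.1, val p.2), val z).
  move=> [[x xF] [y yF]] /=; have [z Fz] := Ft _ _ (set_mem xF) (set_mem yF).
  by have [_ _ zF] := Fc _ _ _ Fz; exists (SigSub (mem_set zF)).
exists f => -[x y] [x' y'] e; have := fF (x, y); rewrite e => /Fi/(_ (fF (x', y'))) /=.
by move=> [] /val_inj -> /val_inj ->.
Qed.

(** The pairs that are new in the larger square are sent into [B] by the given injection. As [B] is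
    disjoint from the old set, no new value collides with an old one. *)
Lemma squaring_extend (T : Type) (F : set (T * T * T)) (B : set T) :
  squaring F -> (forall x, B x -> ~ square_graph F x) ->
  let A := square_graph F `|` B in (A * A)%type <~ B ->
  exists F', [/\ squaring F', F `<=` F' & square_graph F' = A].
Proof.
move=> [Ff Fi Fc Ft] BF A [h hi].
pose new (p : T * T * T) := exists a b : A,
  [/\ ~ (square_graph F p.1.1 /\ square_graph F p.1.2),
     val a = p.1.1, val b = p.1.2 & val (h (a, b)) = p.2].
have newc x y z : new ((x, y), z) -> [/\ A x, A y & B z].
  by move=> [a [b [_ /= <- <- <-]]]; split; apply: set_mem; exact: valP.
have FA x : square_graph F x -> A x by left.
have newt x y : A x -> A y -> ~ (square_graph F x /\ square_graph F y) ->
    exists z, new ((x, y), z).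
  move=> Ax Ay nF; exists (val (h (SigSub (mem_set Ax), SigSub (mem_set Ay)))).
  by exists (SigSub (mem_set Ax)), (SigSub (mem_set Ay)).
have AE : square_graph (F `|` new) = A.
  apply/seteqP; split=> x.
    by move=> [z [Fz|/newc[]//]]; left; exists z.
  move=> Ax; have [[z Fz]|nx] := pselect (square_graph F x).
    by exists z; left.
  by have [|z nz] := newt x x Ax Ax; [case|exists z; right].
exists (F `|` new); split => //; last first.
split.
- move=> [x y] z z' [Fz|nz] [Fz'|nz'].
  + exact: Ff Fz Fz'.
  + by have [Fx Fy _] := Fc _ _ _ Fz; case: nz' => a [b [[]]].
  + by have [Fx Fy _] := Fc _ _ _ Fz'; case: nz => a [b [[]]].
  + case: nz nz' => a [b [/= _ ax by_ <-]] [a' [b' [/= _ ax' by' <-]]].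
    by rewrite -by' in by_; rewrite -ax' in ax; rewrite (val_inj ax) (val_inj by_).
- move=> [x y] [x' y'] z [Fz|nz] [Fz'|nz'].
  + exact: Fi Fz Fz'.
  + by have [_ _ /(BF _)] := newc _ _ _ nz'; have [_ _ Fz''] := Fc _ _ _ Fz.
  + by have [_ _ /(BF _)] := newc _ _ _ nz; have [_ _ Fz''] := Fc _ _ _ Fz'.
  + case: nz nz' => a [b [/= _ <- <- <-]] [a' [b' [/= _ <- <- e]]].
    by move: e => /val_inj/hi[-> ->].
- move=> x y z; rewrite AE => -[Fz|nz].
    by have [? ? ?] := Fc _ _ _ Fz; split; left.
  by have [? ? ?] := newc _ _ _ nz; split => //; right.
- move=> x y; rewrite AE => Ax Ay.
  have [[Fx Fy]|nF] := pselect (square_graph F x /\ square_graph F y).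
    by have [z Fz] := Ft _ _ Fx Fy; exists z; left.
  by have [z nz] := newt _ _ Ax Ay nF; exists z; right.
Qed.

(** The first coordinate records whether a point comes from [A] or only from [B]. *)
Lemma inj_le_setU_prod (T C : Type) (A B : set T) (c0 c1 : C) : c0 <> c1 ->
  A <~ C -> B <~ C -> (A `|` B) <~ (C * C)%type.
Proof.
move=> c01 [f fi] [g gi].
pose h (x : A `|` B) : C * C :=
  match pselect (A (val x)) with
  | left Ax => (c0, f (SigSub (mem_set Ax)))
  | right nAx => (c1,
     match pselect (B (val x)) with
     | left Bx => g (SigSub (mem_set Bx)) | right _ => c0 end)
  end.
exists h => x y; rewrite /h.
case: (pselect (A (val x))) => [Ax|nAx]; case: (pselect (A (val y))) => [Ay|nAy].
- by move=> [/fi[]] /val_inj.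
- by move=> [e]; case: (c01 e).
- by move=> [e]; case: (c01 (esym e)).
case: (pselect (B (val x))) => [Bx|nBx]; last by case: (set_mem (valP x)).
case: (pselect (B (val y))) => [By|nBy]; last by case: (set_mem (valP y)).
by move=> [/gi[]] /val_inj.
Qed.

(** Hessenberg's theorem. Take a maximal set [A] with an injection of its square into itself. If the
    complement contained a copy [B] of [A], the injection would extend to the union of [A] and [B];
    so the complement embeds in [A], and [T] embeds in [A * A], hence in [A]. *)
Lemma inj_le_square (T : Type) : nat <~ T -> (T * T)%type <~ T.
Proof.
move=> [i ii]; have [k ki] := inj_le_nat2.
pose F0 : set (T * T * T) := [set p | exists a b, p = ((i a, i b), i (k (a, b)))].
have F0E a : square_graph F0 (i a) by exists (i (k (a, a))), a, a.
have F0P : squaring F0.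
  split.
  - by move=> p z z' [a [b [-> ->]]] [a' [b' [/ii <- /ii <-]]].
  - by move=> p p' z [a [b [-> ->]]] [a' [b' [-> /ii/ki[-> ->]]]].
  - by move=> x y z [a [b [-> -> ->]]]; split.
  - move=> x y [z [a [_ [-> _ _]]]] [z' [b [_ [-> _ _]]]].
    by exists (i (k (a, b))), a, b.
pose P (F : set (T * T * T)) := squaring F /\ (F = set0 \/ F0 `<=` F).
have [F [[Fs F0F] Fmax]] : exists A, P A /\ forall B, A `<` B -> ~ P B.
  apply: Zorn_bigcup => C CP Ctot; split.
    by apply: squaring_bigcup => // F /CP[].
  have [[F CF sF]|nF] := pselect (exists2 F, C F & F0 `<=` F).
    by right=> p /sF Fp; exists F.
  left; rewrite -subset0 => p [F CF]; case: (CP _ CF) => _ [->//|sF].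
  by case: nF; exists F.
have {}F0F : F0 `<=` F.
  case: F0F => // F_0; case: (Fmax F0); last by split => //; right.
  rewrite F_0; split; first exact: sub0set.
  by move=> /(_ (i 0, i 0, i (k (0, 0))))%N; apply; exists 0%N, 0%N.
set A := square_graph F.
have FA n : A (i n) by have [z Fz] := F0E n; exists z; exact: F0F.
pose c n : A := SigSub (mem_set (FA n)).
have c01 : c 0%N <> c 1%N by move=> [] /ii.
have AA : (A * A)%type <~ A by exact: squaring_inj_le.
have [[h hi]|cAA] := inj_le_total A (~` A).
  pose B : set T := [set x | exists a, val (h a) = x].
  have BF x : B x -> ~ A x by move=> [a <-]; exact: (set_mem (valP (h a))).
  have BA : B <~ A.
    have /choice[g gP] : forall x : B, exists a, val (h a) = val x.
      by move=> x; exact: (set_mem (valP x)).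
    by exists g => x y e; apply: val_inj; rewrite -!gP e.
  have AB : A <~ B.
    exists (fun a => SigSub (mem_set (ex_intro _ a erefl : B (val (h a))))).
    by move=> a b [] /val_inj/hi.
  have UA : (A `|` B) <~ A.
    by apply: inj_le_trans AA; exact: (inj_le_setU_prod c01 (inj_le_refl _) BA).
  have [] := squaring_extend Fs BF.
    exact: (inj_le_trans (inj_le_prod UA UA) (inj_le_trans AA AB)).
  move=> F' [F's FF' F'A]; case: (Fmax F'); last first.
    by split => //; right; exact: subset_trans FF'.
  split => // F'F.
  have Bh : B (val (h (c 0%N))) by exists (c 0%N).
  have : square_graph F' (val (h (c 0%N))) by rewrite F'A; right.
  by move=> [z F'z]; apply: (BF _ Bh); exists z; exact: F'F.
have TA : T <~ A.
  apply: inj_le_trans AA; apply: (@inj_le_trans (A `|` ~` A)).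
    rewrite setUv; exists (fun x => SigSub (mem_setT x)) => x y.
    by move=> /(congr1 val).
  exact: (inj_le_setU_prod c01 (inj_le_refl _) cAA).
apply: (inj_le_trans (inj_le_prod TA TA)); apply: inj_le_trans AA _.
exact: inj_le_set_type.
Qed.

(** * Infinite pseudocompact groups *)

(** An alias of [G] to carry the uniformity of the group, from which regularity and complete
    regularity are obtained. *)
Definition group_uniform (G : topologicalZmodType) : Type := G.

Section group_uniform.
Variable G : topologicalZmodType.
Local Notation H := (group_uniform G).

HB.instance Definition _ := Topological.on H.

Definition group_entourage : set_system (H * H) :=
  [set E | exists2 U : set G, nbhs (0 : G) U &
     forall x y : G, U (y - x) -> E (x, y)].

Lemma nbhs0_sub (U : set G) : nbhs (0 : G) U ->
  exists2 V, nbhs (0 : G) V & forall a b, V a -> V b -> U (a - b).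
Proof.
move=> U0; have := @sub_continuous G (0, 0).
rewrite /continuous_at /= subr0 => /(_ _ U0)[[A B] /= [A0 B0] AB].
exists (A `&` B); first exact: filterI.
by move=> a b [Aa _] [_ Bb]; exact: (AB (a, b)).
Qed.

Lemma nbhs_translate (x : G) (A : set G) :
  nbhs x A <-> nbhs (0 : G) [set y | A (y + x)].
Proof.
split=> [Ax|A0].
  have := @add_continuous G (0, x); rewrite /continuous_at /= add0r.
  move=> /(_ _ Ax)[[B C] /= [B0 Cx] BC].
  by apply: filterS B0 => b Bb; apply: (BC (b, x)); split => //; exact: nbhs_singleton.
have := @sub_continuous G (x, x); rewrite /continuous_at /= subrr.
move=> /(_ _ A0)[[B C] /= [Bx Cx] BC].
apply: filterS Bx => b Bb.
have := BC (b, x) (conj Bb (nbhs_singleton Cx)).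
by rewrite /= subrK.
Qed.

Fact group_entourage_filter : Filter group_entourage.
Proof.
split; first by exists setT => //; exact: filterT.
  move=> E F [U U0 UE] [V V0 VF]; exists (U `&` V); first exact: filterI.
  by move=> x y [/UE ? /VF ?].
by move=> E F EF [U U0 UE]; exists U => // x y /UE/EF.
Qed.

Fact group_entourage_diagonal A : group_entourage A -> diagonal `<=` A.
Proof.
move=> [U U0 UA] [x y] /diagonalP /= <-; apply: UA; rewrite subrr.
exact: nbhs_singleton.
Qed.

Fact group_entourage_inv A : group_entourage A -> group_entourage (A^-1)%relation.
Proof.
move=> [U U0 UA]; have [V V0 VU] := nbhs0_sub U0.
exists V => // x y Vxy; apply: UA; rewrite -opprB -sub0r.
by apply: VU => //; exact: nbhs_singleton.
Qed.

Fact group_entourage_split A : group_entourage A ->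
  exists2 B, group_entourage B & (B \; B `<=` A)%relation.
Proof.
move=> [U U0 UA]; have [V V0 VU] := nbhs0_sub U0.
have [W W0 WV] := nbhs0_sub V0.
exists [set p : G * G | W (p.2 - p.1)]; first by exists W.
move=> [x z] [y /= Wxy Wyz]; apply: UA.
(* Only differences are controlled, so [z - x] is written as [(z - y) - (0 - (y - x))]. *)
rewrite -(subrKA y) -[y - x]opprK -[- (y - x)]sub0r; apply: VU.
  by rewrite -[z - y]subr0; apply: WV => //; exact: nbhs_singleton.
by apply: WV => //; exact: nbhs_singleton.
Qed.

Fact group_entourage_nbhs : nbhs = nbhs_ group_entourage.
Proof.
apply/funext => x; apply/seteqP; split=> A.
  move=> /nbhs_translate A0.
  exists [set p : G * G | A (p.2 - p.1 + x)]; first by exists [set y | A (y + x)].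
  by move=> y /xsectionP /=; rewrite subrK.
move=> [E [U U0 UE] EA]; apply/nbhs_translate; apply: filterS U0 => y Uy.
by apply/EA/xsectionP/UE; rewrite addrK.
Qed.

HB.instance Definition _ := Nbhs_isUniform_mixin.Build H group_entourage_filter
  group_entourage_diagonal group_entourage_inv group_entourage_split
  group_entourage_nbhs.

End group_uniform.

Lemma group_bump (R : realType) (G : topologicalZmodType) (U : set G) (x : G) :
  open U -> U x -> exists f : G -> R, [/\ continuous f, f x = 1,
    forall y, 0 <= f y & forall y, ~ U y -> f y = 0].
Proof.
move=> oU Ux.
have sep : uniform_separator [set x] (~` U).
  have /= := @uniform_completely_regular R (group_uniform G) x (~` U).
  by apply; [rewrite closedC|move=> /(_ Ux)].
have [f [cf f01 fx fU]] := (@uniform_separatorP _ R _ _).1 sep.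
exists (fun y => 1 - f y); split.
- by move=> y; apply: cvgB; [exact: cvg_cst|exact: cf].
- by rewrite (fx (f x)) ?subr0; last by exists x.
- move=> y; rewrite subr_ge0.
  by have /= := f01 (f y) (ex_intro2 _ _ y I erefl); rewrite in_itv /= => /andP[].
- by move=> y Uy; rewrite (fU (f y)) ?subrr; last by exists y.
Qed.

Lemma group_regular (G : topologicalZmodType) : @regular_space G.
Proof. exact: (@uniform_regular (group_uniform G)). Qed.

(** The form in which pseudocompactness is used; the two are equivalent for completely regular
    spaces. Unlike in [selectively_pseudocompact], neighbourhoods need only meet the sets [U n], and
    no points are selected in advance. *)
Definition feebly_compact (X : topologicalType) : Prop :=
  forall U : nat -> set X, (forall n, open (U n) /\ U n !=set0) ->
    exists x : X, forall V, nbhs x V -> infinite_set [set n | V `&` U n !=set0].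

Lemma bounded_nat (A : set nat) : finite_set A ->
  exists N, forall n, A n -> (n < N)%N.
Proof.
move=> /finite_seqP[s ->]; exists (\max_(i <- s) i).+1 => n /= ns.
by rewrite ltnS; exact: (@leq_bigmax_seq _ _ predT id).
Qed.

Lemma unbounded_nat (A : set nat) N : infinite_set A ->
  exists2 n, A n & (N <= n)%N.
Proof.
move=> Ainf; apply: contrapT => nA; apply: Ainf.
apply: (sub_finite_set _ (finite_II N)) => n An /=.
by rewrite ltnNge; apply/negP => Nn; apply: nA; exists n.
Qed.

Lemma infinite_unbounded (A : set nat) :
  (forall N, exists2 n, A n & (N <= n)%N) -> infinite_set A.
Proof.
move=> Aunb /bounded_nat[N AN]; have [n /AN nN Nn] := Aunb N.
by rewrite ltnNge Nn in nN.
Qed.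

Lemma bounded_funP (R : realType) (X : Type) (f : X -> R) :
  bounded_fun f -> exists N : nat, forall x, f x <= N%:R.
Proof.
move=> [M [Mr Mf]].
pose n := `|Num.ceil (M + 1)|%N.
exists n => x; apply: le_trans (ler_norm _) _.
have := Mf (M + 1); rewrite ltrDl ltr01 => /(_ isT x I) /= /le_trans; apply.
by apply: le_trans (ceil_ge _) _; rewrite /n natr_absz ler_int ler_norm.
Qed.

(** If no point is an accumulation point, the sets [U n] form a locally finite family. With bumps
    [f n] supported in [U n], the sum of the functions [n * f n] is then continuous and
    unbounded. *)
Lemma pseudocompact_feebly_compact (R : realType) (X : topologicalType) :
  (forall (U : set X) x, open U -> U x -> exists f : X -> R, [/\ continuous f,
     f x = 1, forall y, 0 <= f y & forall y, ~ U y -> f y = 0]) ->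
  pseudocompact R X -> feebly_compact X.
Proof.
move=> bump psX U UP; apply: contrapT => /forallNP nx.
have {}nx (x : X) : exists V N, nbhs x V /\ forall y n, V y -> U n y -> (n < N)%N.
  have /existsNP[V /not_implyP[xV /contrapT/bounded_nat[N VN]]] := nx x.
  by exists V, N; split=> // y n Vy Uy; apply: VN; exists y.
have /choice[V /choice[N VN]] := nx.
have /choice[f fP] n : exists f : X -> R, exists p, [/\ continuous f, U n p,
    f p = 1, forall y, 0 <= f y & forall y, ~ U n y -> f y = 0].
  have [oU [p Up]] := UP n; have [f [cf fp f0 fU]] := bump _ _ oU Up.
  by exists f, p.
have tail x y n : V x y -> (N x <= n)%N -> f n y = 0.
  move=> Vxy Nn; have [p [_ _ _ _ fU]] := fP n; apply: fU => Uy.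
  by have := (VN x).2 _ _ Vxy Uy; rewrite ltnNge Nn.
have VV x : V x x by apply: nbhs_singleton; exact: (VN x).1.
pose F x := \sum_(i < N x) i%:R * f i x.
(* The number of summands in [F] varies with the point. On [V x] the fixed number [N x] gives the
   same value, because all later summands vanish there. *)
have FE x y : V x y -> F y = \sum_(i < N x) i%:R * f i y.
  move=> Vxy; pose S n := \sum_(i < n) i%:R * f i y.
  have SE m z n : V z y -> (N z <= m)%N -> (m <= n)%N -> S n = S m.
    move=> Vzy zm /subnK <-; elim: (n - m)%N => [//|k IH].
    rewrite addSn /S big_ord_recr /= (tail z) ?mulr0 ?addr0 //.
    by apply: leq_trans zm _; exact: leq_addl.
  transitivity (S (maxn (N x) (N y))); [symmetry|].
    by apply: (SE _ y) => //; exact: leq_maxr.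
  by apply: (SE _ x) => //; exact: leq_maxl.
have cF : continuous F.
  move=> x; have [xV _] := VN x.
  pose S y := \sum_(i < N x) i%:R * f i y.
  have cS : continuous S.
    apply: (@continuous_big R _ +%R 0 _ _ _ _ (fun (i : 'I_(N x)) y => i%:R * f i y)).
      exact: add_continuous.
    move=> i _ y; apply: cvgM; first exact: cvg_cst.
    by have [p [cf _ _ _ _]] := fP i; exact: cf.
  rewrite /continuous_at (FE x x) //; apply: cvg_trans (cS x).
  apply: near_eq_cvg; near=> y; rewrite (FE x y) //; near: y; exact: xV.
have [M FM] := bounded_funP (psX F cF).
have [p [_ Up fp f0 _]] := fP M.+1.
have := FM p; apply/negP; rewrite -ltNge.
have MN : (M.+1 < N p)%N by apply: (VN p).2 Up; exact: VV.
rewrite /F (bigD1 (Ordinal MN)) //= fp mulr1.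
apply: (@lt_le_trans _ _ M.+1%:R); first by rewrite ltr_nat.
rewrite lerDl; apply: sumr_ge0 => i _; apply: mulr_ge0 => //.
by have [? [_ _ _ + _]] := fP i; apply.
Unshelve. all: by end_near. Qed.

Section feebly_compact_baire.
Variable X : topologicalType.
Hypotheses (X_regular : @regular_space X) (X_fc : feebly_compact X).

Lemma regular_shrink (U : set X) : open U -> U !=set0 ->
  exists W, [/\ open W, W !=set0 & closure W `<=` U].
Proof.
move=> oU [x Ux]; have [B xB BU] := X_regular (open_nbhs_nbhs (conj oU Ux)).
exists (interior B); split; first exact: open_interior.
  by exists x.
exact: subset_trans (closure_subset (@interior_subset _ _)) BU.
Qed.

(** As the sets decrease, an accumulation point of the sequence lies in the closure of each
    [O n.+1]. *)
Lemma nested_open_meet (O : nat -> set X) :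
  (forall n, open (O n) /\ O n !=set0) ->
  (forall n, closure (O n.+1) `<=` O n) -> exists x, forall n, O n x.
Proof.
move=> oO clO; have [x xO] := X_fc oO; exists x => n; apply: (clO n) => V xV.
have [m [y [Vy Oy]] nm] := unbounded_nat n.+1 (xO V xV).
exists y; split=> //; elim: m nm Oy {xO} => // m IH.
rewrite leq_eqVlt => /predU1P[->//|nm] Oy; apply: IH => //.
exact/clO/subset_closure.
Qed.

(** Baire's argument, with feeble compactness instead of completeness: if all [C n] had empty
    interior, nested open sets could be chosen to avoid them one after another. *)
Lemma feebly_compact_baire (C : nat -> set X) :
  [set: X] !=set0 -> (forall n, closed (C n)) -> \bigcup_n C n = setT ->
  exists n, interior (C n) !=set0.
Proof.
move=> X0 clC CT; apply: contrapT => /forallNP nC.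
(* The premises stand under the existential so that choice yields a total function, with dummy
   values at bad arguments. *)
have step (p : nat * set X) : exists W, open p.2 /\ p.2 !=set0 ->
    [/\ open W, W !=set0 & closure W `<=` p.2 `\` C p.1].
  case: p => n U /=; have [[oU U0]|nU] := pselect (open U /\ U !=set0); last first.
    by exists set0.
  have oUC : open (U `\` C n) by rewrite setDE; apply: openI => //; rewrite openC.
  have [|W [oW W0 WU]] := regular_shrink oUC; last by exists W.
  apply: contrapT => UC; apply: (nC n); case: U0 => x Ux; exists x.
  apply: (@filterS _ _ _ U); last exact: open_nbhs_nbhs.
  by move=> y Uy; apply: contrapT => nCy; apply: UC; exists y.
have [next nextP] := choice step.
pose fix O n := if n is m.+1 then next (m, O m) else setT.
have OP n : open (O n) /\ O n !=set0.
  elim: n => [|n IH]; first by split => //; exact: openT.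
  by have [] := nextP (n, O n) IH.
have OS n : closure (O n.+1) `<=` O n `\` C n by have [] := nextP (n, O n) (OP n).
have [|x xO] := nested_open_meet OP; first by move=> n x /OS[].
have [n _ Cx] : (\bigcup_n C n) x by rewrite CT.
by have [] := OS n x (subset_closure (xO n.+1)).
Qed.

(** A Cantor scheme: each nonempty open set contains the closures of two disjoint nonempty open
    sets, and each branch of the resulting binary tree has a common point. *)
Lemma feebly_compact_perfect : hausdorff_space X -> [set: X] !=set0 ->
  (forall x : X, ~ open [set x]) -> (nat -> bool) <~ X.
Proof.
move=> hX X0 noX.
have step (U : set X) : exists W : bool -> set X, open U /\ U !=set0 ->
    (forall b, [/\ open (W b), W b !=set0 & closure (W b) `<=` U]) /\
    W true `&` W false = set0.
  have [[oU [x Ux]]|nU] := pselect (open U /\ U !=set0); last by exists (fun=> U).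
  have [y [Uy xy]] : exists y, U y /\ x != y.
    apply: contrapT => /forallNP ny; apply: (noX x); suff -> : [set x] = U by [].
    apply/seteqP; split=> [_ -> //|y Uy] /=; have [->//|xy] := eqVneq x y.
    by case: (ny y).
  move: (hX); rewrite open_hausdorff => /(_ _ _ xy)[[A B] /= [xA yB] [oA oB /eqP AB]].
  rewrite !inE in xA yB.
  have [V1 [oV1 V1n V1U]] : exists W, [/\ open W, W !=set0 & closure W `<=` U `&` A].
    by apply: regular_shrink; [exact: openI|exists x].
  have [V2 [oV2 V2n V2U]] : exists W, [/\ open W, W !=set0 & closure W `<=` U `&` B].
    by apply: regular_shrink; [exact: openI|exists y].
  exists (fun b => if b then V1 else V2) => _; split.
    by case; split => //; [move=> z /V1U[]|move=> z /V2U[]].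
  rewrite -subset0 -AB => z [/subset_closure/V1U[_ Az] /subset_closure/V2U[_ Bz]].
  by split.
have [next nextP] := choice step.
pose fix O b n := if n is m.+1 then next (O b m) (b m) else setT.
have OP b n : open (O b n) /\ O b n !=set0.
  elim: n => [|n IH]; first by split => //; exact: openT.
  by have [/(_ (b n))[]] := nextP _ IH.
have /choice[p pO] (b : nat -> bool) : exists x, forall n, O b n x.
  by apply: nested_open_meet => // n; have [/(_ (b n))[]] := nextP _ (OP b n).
exists p => b c pbc; apply/funext => n.
(* Branches that agree before [m] share the set at level [m]; the common point cannot lie in both of
   its disjoint successors, so they also agree at [m]. *)
suff /(_ n.+1)/(_ n (ltnSn n)) : forall m, forall k, (k < m)%N -> b k = c k by [].
elim=> // m IH k; rewrite ltnS leq_eqVlt => /predU1P[->|/IH//].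
have {}IH : O b m = O c m.
  elim: m IH {k} => //= m IHm bc; rewrite bc // IHm // => k km.
  by apply: bc; exact: leq_trans km _.
have [_ disj] := nextP _ (OP b m).
have := pO b m.+1; have := pO c m.+1; rewrite /= -IH pbc.
move: disj; rewrite -subset0 => disj.
by case: (b m); case: (c m) => // ? ?; case: (disj (p c)).
Qed.

End feebly_compact_baire.

(** A point of the closure is determined by the traces of its neighbourhoods on [A], since the
    traces of disjoint neighbourhoods of two points differ. *)
Lemma closure_inj_le (X : topologicalType) (A : set X) :
  hausdorff_space X -> closure A <~ set (set A).
Proof.
move=> hX; pose tr (U : set X) : set A := [set a | U (val a)].
exists (fun x : closure A => [set S | exists2 U, nbhs (val x) U & S = tr U]).
move=> [x xA] [y yA] /= e; apply/val_inj => /=; apply: hX => U V xU yV.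
have : [set S | exists2 W, nbhs x W & S = tr W] (tr U) by exists U.
rewrite e => -[W yW UW].
have [a [Aa [Va Wa]]] := set_mem yA _ (filterI yV yW).
exists a; split=> //.
have : tr W (SigSub (mem_set Aa)) by [].
by rewrite -UW.
Qed.

(** Precompactness. Otherwise there is a sequence none of whose terms lies in the translates of [U]
    by earlier ones; small neighbourhoods of its terms accumulate somewhere, which makes two terms
    too close. *)
Lemma feebly_compact_cover (G : topologicalZmodType) (U : set G) :
  feebly_compact G -> open U -> U !=set0 ->
  exists s : seq G, forall g, exists2 x, x \in s & U (g - x).
Proof.
move=> fcG oU [u Uu]; apply: contrapT => /forallNP ns.
have /nbhs0_sub[V1 V10 V1U] : nbhs (0 : G) [set y | U (y + u)].
  by apply: (nbhs_translate u U).1; apply: open_nbhs_nbhs; split.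
have [V2 V20 V21] := nbhs0_sub V10.
have [V [oV V0] V2V] : exists2 V, open_nbhs (0 : G) V & V `<=` V2.
  by move: V20; rewrite nbhsE => -[V]; exists V.
have /choice[next nextP] (s : seq G) :
    exists g, forall x, x \in s -> ~ U (g - x + u).
  have /existsNP[g gs] := ns [seq x - u | x <- s].
  exists g => x xs Ux; apply: gs; exists (x - u); first exact: map_f.
  by rewrite opprB addrA addrAC.
pose fix s n := if n is m.+1 then next (s m) :: s m else [::].
have sub m n : (m < n)%N -> next (s m) \in s n.
  elim: n => // n IH; rewrite ltnS leq_eqVlt => /predU1P[->|/IH mn].
    exact: mem_head.
  by rewrite inE mn orbT.
pose tr (x : G) (W : set G) : set G := [set y | W (y - x)].
have trO x W : open W -> open (tr x W).
  rewrite !openE => oW y /oW /nbhs_translate W0; apply/nbhs_translate.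
  by apply: filterS W0 => z; rewrite /= /tr /= addrA.
have [|x xP] := fcG (fun n => tr (next (s n)) V).
  move=> n; split; first exact: trO.
  by exists (next (s n)); rewrite /tr /= subrr.
have xV : nbhs x (tr x V).
  by apply: open_nbhs_nbhs; split; [exact: trO|rewrite /tr /= subrr].
have [m [y [yx ym]] _] := unbounded_nat 0 (xP _ xV).
have [n [z [zx zn]] mn] := unbounded_nat m.+1 (xP _ xV).
apply: (nextP (s n) (next (s m)) (sub _ _ mn)).
have e (a b c : G) : b - a - (b - c) = c - a by rewrite opprB addrC addrA subrK.
(* The two terms are joined through [y], [x] and [z]; each of the four differences lies in [V]. *)
have -> : next (s n) - next (s m) =
    (y - next (s m) - (y - x)) - (z - next (s n) - (z - x)).
  by rewrite !e.
by apply: V1U; apply: V21; exact: V2V.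
Qed.

(** By Baire some [A n] has a closure with interior, finitely many translates of which cover [G]. A
    point is thus coded by the index of a translate and a point of the closure. *)
Lemma feebly_compact_inj_le (G : topologicalZmodType) (A : nat -> set G) :
  hausdorff_space G -> feebly_compact G -> \bigcup_n A n = setT ->
  exists n, G <~ (nat * set (set (A n)))%type.
Proof.
move=> hG fcG AT.
have [|n||n [x xA]] := feebly_compact_baire (@group_regular G) fcG
  (C := fun n => closure (A n)).
- by exists 0.
- exact: closed_closure.
- by rewrite -subTset -AT => y [n _ Any]; exists n => //; exact: subset_closure.
have [|s sP] := feebly_compact_cover fcG (@open_interior _ (closure (A n))).
  by exists x.
exists n; have [h hi] := @closure_inj_le _ (A n) hG.
have /choice[i iP] (g : G) : exists i, closure (A n) (g - nth 0 s i).
  have [y ys yA] := sP g; exists (index y s); rewrite nth_index //.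
  exact: interior_subset.
exists (fun g => (i g, h (SigSub (mem_set (iP g))))) => g g' [ii /hi[]].
by rewrite ii => /addIr.
Qed.

(** By translation one isolated point makes the group discrete, and then every function is
    continuous, including unbounded ones. *)
Lemma pseudocompact_group_perfect (R : realType) (G : topologicalZmodType) :
  infinite_set [set: G] -> pseudocompact R G -> forall x : G, ~ open [set x].
Proof.
move=> /infinite_inj_le[i ii] psG x0 ox0.
have o1 (x : G) : nbhs x [set x].
  apply/nbhs_translate.
  have /nbhs_translate : nbhs x0 [set x0] by apply: open_nbhs_nbhs; split.
  apply: filterS => y /= yx; rewrite -[x in RHS]add0r; congr (_ + _).
  by apply: (addIr x0); rewrite add0r.
have [f fi] : exists f : G -> nat, forall n, f (i n) = n.
  have [f fP] : {f : G -> nat & forall g, forall n, i n = g -> f g = n}.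
    apply: (@choice _ _ (fun g m => forall n, i n = g -> m = n)) => g.
    have [[n <-]|ng] := pselect (exists n, i n = g).
      by exists n => m /ii.
    by exists 0%N => n ing; case: ng; exists n.
  by exists f => n; exact: fP.
have cf : continuous (fun g => (f g)%:R : R).
  by move=> x V Vx; apply: filterS (o1 x) => _ ->; exact: (nbhs_singleton Vx).
have [N NP] := bounded_funP (psG _ cf).
by have := NP (i N.+1); rewrite fi ler_nat ltnn.
Qed.

Lemma pseudocompact_group_feebly_compact (R : realType) (G : topologicalZmodType) :
  pseudocompact R G -> feebly_compact G.
Proof. by apply: pseudocompact_feebly_compact; exact: group_bump. Qed.

Lemma pseudocompact_group_continuum (R : realType) (G : topologicalZmodType) :
  hausdorff_space G -> infinite_set [set: G] -> pseudocompact R G ->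
  (nat -> bool) <~ G.
Proof.
move=> hG Ginf psG; apply: (feebly_compact_perfect (@group_regular G)) => //.
- exact: pseudocompact_group_feebly_compact psG.
- by exists 0.
- exact: pseudocompact_group_perfect psG.
Qed.

(** * The exponent *)

Section well_order_facts.
Variables (T : eqType) (r : rel T).
Hypothesis wo : wochoice.well_order r.

(** The order axioms are recovered from least elements of sets with at most three points. *)
Lemma well_order_total : total r.
Proof.
move=> x y; have [|z [[+ zP] _]] := wo (A := pred2 x y).
  by exists x; rewrite inE /= eqxx.
have := zP x; have := zP y; rewrite !inE /= !eqxx orbT /=.
by move=> /(_ isT) zy /(_ isT) zx /pred2P[e|e]; rewrite e in zx zy; rewrite ?zx ?zy ?orbT.
Qed.

Lemma well_order_refl : reflexive r.
Proof. by move=> x; have := well_order_total x x; rewrite orbb. Qed.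

Lemma well_order_antisym : antisymmetric r.
Proof.
move=> x y /andP[xy yx]; have [|z [_ zU]] := wo (A := pred2 x y).
  by exists x; rewrite inE /= eqxx.
have zx : z = x.
  apply: zU; split; first by rewrite inE /= eqxx.
  by move=> w; rewrite inE => /pred2P[->|->//]; exact: well_order_refl.
rewrite -zx; apply: zU; split; first by rewrite inE /= eqxx orbT.
by move=> w; rewrite inE => /pred2P[->//|->]; exact: well_order_refl.
Qed.

Lemma well_order_trans : transitive r.
Proof.
move=> y x z xy yz; have [|w [[+ wP] _]] := wo (A := pred3 x y z).
  by exists x; rewrite inE /= eqxx.
have := wP x; have := wP y; have := wP z; rewrite !inE /= !eqxx !orbT /=.
move=> /(_ isT) wz /(_ isT) wy /(_ isT) wx /or3P[]/eqP e; rewrite e in wx wy wz => //.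
  by have -> : x = y by apply: well_order_antisym; rewrite xy wx.
by have -> : z = y by apply: well_order_antisym; rewrite wy yz.
Qed.

Lemma well_order_min (P : T -> Prop) : (exists x, P x) ->
  exists2 x, P x & forall y, P y -> r x y.
Proof.
move=> [x Px]; have [|m [[mP mmin] _]] := wo (A := fun x => `[< P x >]).
  by exists x; exact/asboolP.
exists m; first exact/asboolP.
by move=> y Py; apply: mmin; exact/asboolP.
Qed.

Lemma well_order_seq_bound (s : seq T) : s != [::] ->
  exists m, forall x, x \in s -> r x m.
Proof.
elim: s => // x [|y s] IH _.
  by exists x => z; rewrite inE => /eqP ->; exact: well_order_refl.
have [//|m mP] := IH; have /orP[xm|mx] := well_order_total x m.
  by exists m => z; rewrite inE => /predU1P[->//|]; exact: mP.
exists x => z; rewrite inE => /predU1P[->|/mP zm]; first exact: well_order_refl.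
exact: well_order_trans zm mx.
Qed.

End well_order_facts.

Definition initial_segment (T : Type) (r : rel T) (x : T) : set T :=
  [set y | r y x /\ y <> x].

Lemma inj_le_set (T U : Type) : T <~ U -> set T <~ set U.
Proof. exact: (inj_le_dom True). Qed.

Lemma inj_le_set_set (T U : Type) : T <~ U -> set (set T) <~ set (set U).
Proof. by move=> /inj_le_set/inj_le_set. Qed.

Lemma inj_le_option (T U : Type) : T <~ U -> option T <~ option U.
Proof.
move=> [f fi]; exists (omap f) => -[x|] [y|] //=.
by move=> [/fi->].
Qed.

Lemma inj_le_option_infinite (T : Type) : nat <~ T -> option T <~ T.
Proof.
move=> nT; apply: inj_le_trans (inj_le_square nT); have [i ii] := nT.
exists (fun x => if x is Some y then (i 0%N, y) else (i 1%N, i 0%N)).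
by move=> [x|] [y|] // []; [move=> ->|move=> /ii|move=> /ii].
Qed.

Lemma inj_le_option_nat (T : Type) : nat <~ T -> (option T * nat)%type <~ T.
Proof.
move=> nT; apply: inj_le_trans (inj_le_square nT).
exact: inj_le_prod (inj_le_option_infinite nT) nT.
Qed.

(* With the factor nat, nonempty exponents T have the closure properties of infinite
   ones, and with option the empty one does too. *)
Definition power_nat (T : Type) : Type := (option T * nat)%type -> bool.

Lemma inj_le_power_nat (T U : Type) : T <~ U -> power_nat T <~ power_nat U.
Proof.
move=> TU; apply: (inj_le_dom true); apply: inj_le_prod (inj_le_refl _).
exact: inj_le_option.
Qed.

Lemma power_nat_infinite (T : Type) : nat <~ power_nat T.
Proof.
exists (fun n p => p.2 == n) => m n e.
by have /= := congr1 (fun k => k (None, m)) e; rewrite eqxx => /esym/eqP.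
Qed.

Lemma power_nat_seq (T : Type) : (nat -> power_nat T) <~ power_nat T.
Proof.
apply: (inj_le_trans (inj_le_curry _ _ _)); apply: (inj_le_dom true).
apply: (@inj_le_trans (option T * (nat * nat))).
  by exists (fun p => (p.2.1, (p.1, p.2.2))) => -[a [b c]] [a' [b' c']] /= [-> -> ->].
by apply: inj_le_prod inj_le_nat2; exact: inj_le_refl.
Qed.

Lemma option_inj_le_power_nat (T : Type) : option T <~ power_nat T.
Proof.
apply: (inj_le_trans (inj_le_singleton _)).
exists (fun f p => f p.1) => f g e; apply/funext => x.
exact: (congr1 (fun k => k (x, 0%N)) e).
Qed.

(** A sequence is coded by its graph. *)
Lemma seq_inj_le_power_nat (T : Type) : (nat -> T) <~ power_nat T.
Proof.
exists (fun a p => `[< p.1 = Some (a p.2) >]) => a b e; apply/funext => n.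
have /= := congr1 (fun k => k (Some (a n), n)) e; rewrite [LHS]asboolT //.
by move=> /esym/asboolP[].
Qed.

Lemma power_nat_infinite_inj_le (T : Type) : nat <~ T -> power_nat T <~ (T -> bool).
Proof. by move=> nT; apply: (inj_le_dom true); exact: inj_le_option_nat. Qed.

Lemma not_power_nat_inj_le (T K : Type) : nat <~ T ->
  ~ power_nat T <~ K -> K <~ set (set T).
Proof.
move=> nT nTK; have [//|KT] := inj_le_total (power_nat T) K.
apply: (inj_le_trans KT); apply: (inj_le_trans (power_nat_infinite_inj_le nT)).
apply: (@inj_le_trans (set T)); first exact: inj_le_bool_set.
apply: (inj_le_trans _ (inj_le_bool_set _)); exact: inj_le_singleton.
Qed.

Lemma inj_le_real (R : realType) : R <~ (nat -> bool).
Proof.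
apply: (@inj_le_trans (set rat)).
  exists (fun x => [set q | ratr q < x]) => x y e.
  apply: contrapT => /eqP; rewrite neq_lt => /orP[] /rat_in_itvoo[q];
    rewrite in_itv /= => /andP[q1 q2].
    have : [set p | ratr p < x] q by rewrite e.
    by rewrite /= ltNge (ltW q1).
  have : [set p | ratr p < y] q by rewrite -e.
  by rewrite /= ltNge (ltW q1).
apply: (inj_le_trans (inj_le_set_bool _)); apply: (inj_le_dom true).
by apply/inj_leP; have /card_eqPle[] := card_rat.
Qed.

Section segment.
Variables (K : choiceType).

(** The least cardinal whose power exceeds [K], presented as a well-order whose proper initial
    segments have powers embedding in [K]. *)
Lemma least_power_nat : exists (T : choiceType) (r : rel T),
  [/\ T <~ K, wochoice.well_order r, ~ power_nat T <~ K &
      forall x, power_nat (initial_segment r x) <~ K].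
Proof.
have [r wo] := wochoice.well_ordering_principle K.
have rtot := well_order_total wo.
have ranti := well_order_antisym wo.
(* [A] is the shortest initial segment of [K] whose power does not embed in [K], or all of [K] if no
   proper one qualifies; by Cantor's theorem [K] itself does. *)
have [A [Adown AK Aseg]] : exists A : set K,
    [/\ forall x y, A x -> r y x -> A y, ~ power_nat A <~ K &
        forall x, A x -> power_nat (initial_segment r x) <~ K].
  have [ex|nex] := pselect (exists x, ~ power_nat (initial_segment r x) <~ K).
    have [x xK xmin] := well_order_min wo ex; exists (initial_segment r x).
    split=> // [y z [yx nyx] zy|y [yx nyx]].
      split; first exact: (well_order_trans wo) zy yx.
      by move=> zx; apply: nyx; apply: ranti; rewrite yx -zx.
    by apply: contrapT => /xmin xy; apply: nyx; apply: ranti; rewrite yx.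
  exists setT; split=> // [|x _].
    move=> KK; apply: (@cantor_inj_le K); apply: inj_le_trans KK.
    apply: (@inj_le_trans (option [set: K] -> bool)).
      apply: (inj_le_dom true); exists (fun x => Some (SigSub (mem_setT x))).
      by move=> x y [].
    exists (fun f p => f p.1) => f g e; apply/funext => x.
    exact: (congr1 (fun k => k (x, 0%N)) e).
  by apply: contrapT => xK; apply: nex; exists x.
exists A, (fun x y : A => r (val x) (val y)); split.
- exact: inj_le_set_type.
- move=> P [x Px].
  have [|_ [m mP <-] mmin] :=
    well_order_min wo (P := [set val y | y in [set y : A | y \in P]]).
    by exists (val x), x.
  have mlb y : y \in P -> r (val m) (val y) by move=> Py; apply: mmin; exists y.
  exists m; split=> [|m' [m'P m'min]]; first by split.
  by apply/val_inj/ranti; rewrite mlb ?m'min.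
- by [].
- move=> x; apply: inj_le_trans (Aseg _ (set_mem (valP x))).
  apply: inj_le_power_nat.
  have seg (y : initial_segment (fun x y : A => r (val x) (val y)) x) :
      initial_segment r (val x) (val (val y)).
    by have [yx nyx] := set_mem (valP y); split=> // /val_inj.
  exists (fun y => SigSub (mem_set (seg y))) => y z [].
  by move=> /val_inj/val_inj.
Qed.

End segment.

Section exponent.
Variables (K T : choiceType) (r : rel T).
Hypotheses (KK : (K * K)%type <~ K) (cK : (nat -> bool) <~ K).
Hypotheses (TK : T <~ K) (wo : wochoice.well_order r).
Hypotheses (Tbig : ~ power_nat T <~ K)
  (Tseg : forall x, power_nat (initial_segment r x) <~ K).
(** This expresses that no [power_nat M] can serve as the exponent. *)
Hypothesis K_gap : forall M : Type, power_nat M <~ K ->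
  set (set (power_nat M)) <~ K.

Let seg := initial_segment r.

Lemma exponent_uncountable : ~ T <~ nat.
Proof.
move=> Tn; apply: Tbig; apply: inj_le_trans cK.
apply: (inj_le_trans (inj_le_power_nat Tn)).
exact: (power_nat_infinite_inj_le (inj_le_refl _)).
Qed.

Lemma exponent_infinite : nat <~ T.
Proof. by have [/exponent_uncountable|] := inj_le_total T nat. Qed.

(** The strong limit property of [T]: otherwise [power_nat T] would embed in the double power set of
    [power_nat M], hence in [K] by the gap. *)
Lemma gap_not_inj_le (M : Type) : power_nat M <~ K -> ~ T <~ set (power_nat M).
Proof.
move=> MK TM; apply: Tbig; apply: inj_le_trans (K_gap MK).
apply: (inj_le_trans (inj_le_power_nat TM)).
apply: (inj_le_trans (power_nat_infinite_inj_le _)).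
  apply: (inj_le_trans (power_nat_infinite M)).
  exact: (inj_le_trans (inj_le_singleton _) (inj_le_bool_set _)).
exact: inj_le_bool_set.
Qed.

(** If [x] were the greatest element, [T] would be its segment with one point added, too small by
    the gap. *)
Lemma exponent_limit x : exists2 y, r x y & y <> x.
Proof.
apply: contrapT => nx; apply: (gap_not_inj_le (Tseg x)).
apply: (@inj_le_trans (option (seg x))); last first.
  apply: (inj_le_trans (option_inj_le_power_nat _)).
  exact: (inj_le_trans (inj_le_singleton _) (inj_le_bool_set _)).
have segx y : y <> x -> seg x y.
  move=> yx; split=> //; have /orP[//|xy] := well_order_total wo y x.
  by case: nx; exists y.
exists (fun y => if pselect (y <> x) is left yx
  then Some (SigSub (mem_set (segx y yx))) else None) => y z.
case: pselect => [yx|/contrapT ->]; case: pselect => [zx|/contrapT ->] //.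
by move=> [].
Qed.

(** The case of uncountable cofinality: a sequence is coded by a bound [x] and by its code as a
    sequence in the segment of [x], and for each [x] these codes embed in [K]. *)
Lemma exponent_seq_bounded :
  (forall a : nat -> T, exists x, forall n, seg x (a n)) -> (nat -> T) <~ K.
Proof.
move=> /choice[b bP]; have [i ii] := TK.
have /choice[j jP] x : exists j : (nat -> T) -> K, forall a a',
    (forall n, seg x (a n)) -> (forall n, seg x (a' n)) -> j a = j a' -> a = a'.
  have [f fi] := inj_le_trans (seq_inj_le_power_nat (seg x)) (Tseg x).
  exists (fun a => if pselect (forall n, seg x (a n)) is left H
    then f (fun n => SigSub (mem_set (H n))) else i x) => a a' ax a'x.
  case: pselect => // H; case: pselect => // H' /fi e; apply/funext => n.
  exact: (congr1 (fun k => val (k n)) e).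
apply: inj_le_trans KK; exists (fun a => (i (b a), j (b a) a)) => a a' [/ii ba].
by rewrite ba; apply: jP => //; rewrite -ba.
Qed.

Lemma exponent_cofinal_infinite (A : set T) : cofinal_in r A -> infinite_set A.
Proof.
move=> cA /finite_seqP[s sA]; have [i _] := exponent_infinite.
have [y Ay _] := cA (i 0%N).
have [|m mP] := well_order_seq_bound wo (s := s).
  by move: Ay; rewrite sA /=; case: s {sA}.
have [z mz nzm] := exponent_limit m; have [w + zw] := cA z.
rewrite sA => /mP wm; apply: nzm; apply: (well_order_antisym wo).
by rewrite mz (well_order_trans wo zw).
Qed.

(** The case of countable cofinality: SCH makes [nat -> T] the successor cardinal of [T], hence at
    most [K], as [K] is larger than [T]. *)
Lemma exponent_seq_cofinal (a : nat -> T) : SCH ->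
  (forall x, exists n, ~ seg x (a n)) ->
  ~ K <~ T -> (nat -> T) <~ K.
Proof.
move=> sch cof KT.
have cofa : cofinal_in r (range a).
  move=> x; have [y xy nyx] := exponent_limit x.
  have [n na] := cof y; exists (a n); first by exists n.
  apply: (well_order_trans wo xy); have /orP[//|any] := well_order_total wo y (a n).
  have [->|/eqP ne] := eqVneq (a n) y; first exact: well_order_refl.
  by case: na; split.
have nT := exponent_infinite.
have Tinf : infinite_set [set: T] by apply/infinite_inj_le.
have card_lt_of (A B : Type) : A <~ B -> ~ B <~ A -> [set: A] #< [set: B].
  by move=> AB BA; split; [exact/inj_leP|move=> /inj_leP].
have [|||_] := sch T nat Tinf.
- exists r; split.
  (* If [T] embedded in a proper segment, its power would embed in [K] along with that of the
     segment. *)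
  + split=> // x; split; first exact: subset_card_le.
    move=> /card_le_injP TS; apply: Tbig; apply: inj_le_trans (Tseg x).
    apply: inj_le_power_nat; apply: inj_le_trans TS.
    by exists (fun y => SigSub (mem_setT y)) => y z /(congr1 val).
  + exists (range a) => //; apply: eq_card_nat.
      exact: sub_countable (card_image_le _ _) (countableP _).
    exact: (exponent_cofinal_infinite cofa).
  + by move=> A /exponent_cofinal_infinite/infiniteP.
- exact: card_lt_of nT exponent_uncountable.
(* The gap at [M = nat], which applies because [K] has at least continuum many elements. *)
- have cT : ~ T <~ set nat.
    move=> Tn; have nK : power_nat nat <~ K.
      apply: inj_le_trans cK; exact: (power_nat_infinite_inj_le (inj_le_refl _)).
    apply: (gap_not_inj_le nK); apply: (inj_le_trans Tn); apply: inj_le_set.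
    exact: power_nat_infinite.
  by apply: card_lt_of => //; have [] := inj_le_total T (set nat).
move=> /(_ K (card_lt_of _ _ TK KT))/inj_leP; exact.
Qed.

(** An embedding of [G] in [T] would divide [G] into countably many sets, each of the size of a
    proper segment at most. By Baire and precompactness [G], hence [T], would then be bounded by a
    double power of a segment, against the gap. *)
Lemma exponent_cover (G : topologicalZmodType) (a : nat -> T) :
  hausdorff_space G -> feebly_compact G -> (forall x, exists n, ~ seg x (a n)) ->
  T <~ G -> ~ G <~ T.
Proof.
move=> hG fcG cof TG [i ii].
have [|n Gn] := @feebly_compact_inj_le G (fun n => [set g | seg (a n) (i g)]) hG fcG.
  rewrite -subTset => g _; have [y gy nyg] := exponent_limit (i g).
  have [n na] := cof y; exists n => //=.
  have ya : r y (a n).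
    have /orP[//|any] := well_order_total wo y (a n).
    have [->|/eqP ne] := eqVneq (a n) y; first exact: well_order_refl.
    by case: na; split.
  split; first exact: (well_order_trans wo gy).
  move=> ga; apply: nyg; apply: (well_order_antisym wo).
  by rewrite gy ga ya.
apply: (gap_not_inj_le (Tseg (a n))).
apply: (inj_le_trans TG); apply: (inj_le_trans Gn).
have An : [set g | seg (a n) (i g)] <~ seg (a n).
  exists (fun g => SigSub (mem_set (set_mem (valP g) : seg (a n) (i (val g))))).
  by move=> g h [] /ii/val_inj.
have nP : nat <~ set (power_nat (seg (a n))).
  apply: (inj_le_trans (power_nat_infinite (seg (a n)))).
  exact: (inj_le_trans (inj_le_singleton _) (inj_le_bool_set _)).
apply: (inj_le_trans _ (inj_le_square nP)); apply: (inj_le_prod nP).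
apply: inj_le_set; apply: (inj_le_trans (inj_le_set An)).
apply: (inj_le_trans (inj_le_set_bool _)).
exists (fun f p => oapp f false p.1) => f g e; apply/funext => x.
exact: (congr1 (fun k => k (Some x, 0%N)) e).
Qed.

End exponent.

Lemma pseudocompact_group_exponent (R : realType) (G : topologicalZmodType) :
  hausdorff_space G -> infinite_set [set: G] -> pseudocompact R G ->
  ([set: G] #<= [set: set (set R)]) \/ SCH ->
  exists T : Type, [/\ nat <~ T, (nat -> T) <~ G & G <~ set (set T)].
Proof.
move=> hG Ginf psG small.
have cG := pseudocompact_group_continuum hG Ginf psG.
have GG := inj_le_square ((infinite_inj_le _).1 Ginf).
have nc : nat <~ (nat -> bool) := inj_le_singleton _.
case: small => [/inj_leP small|sch].
  (* The continuum equals its countable power and embeds in [G]. *)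
  exists (nat -> bool); split => //; last first.
    by apply: (inj_le_trans small); apply: inj_le_set_set; exact: inj_le_real.
  apply: inj_le_trans cG; apply: (inj_le_trans (inj_le_curry _ _ _)).
  exact: (inj_le_dom true inj_le_nat2).
have [[M [MG GM]]|nM] := pselect (exists M : Type,
    power_nat M <~ G /\ G <~ set (set (power_nat M))).
  exists (power_nat M); split => //; first exact: power_nat_infinite.
  exact: inj_le_trans (power_nat_seq _) MG.
have gap (M : Type) : power_nat M <~ G -> set (set (power_nat M)) <~ G.
  by move=> MG; have [GM|//] := inj_le_total G (set (set (power_nat M)));
    case: nM; exists M.
have [T [r [TG wo Tbig Tseg]]] := least_power_nat G.
have nT : nat <~ T := exponent_infinite cG Tbig.
exists T; split=> //; last exact: not_power_nat_inj_le nT Tbig.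
have [bnd|/existsNP[a /forallNP aP]] :=
    pselect (forall a : nat -> T, exists x, forall n, initial_segment r x (a n)).
  exact: exponent_seq_bounded GG TG Tseg bnd.
have {}aP x : exists n, ~ initial_segment r x (a n) by exact/existsNP/aP.
apply: (exponent_seq_cofinal cG TG wo Tbig Tseg gap sch aP).
apply: (exponent_cover wo Tbig Tseg gap hG _ aP TG).
exact: pseudocompact_group_feebly_compact psG.
Qed.

(** * Boolean groups *)

(** Homomorphisms to Z/2, whose addition is [addb]. On a Boolean group they represent the
    circle-valued homomorphisms, which only take the values 1 and -1. *)
Definition bool_hom (G : zmodType) (f : G -> bool) : Prop :=
  forall x y, f (x + y) = f x (+) f y.

Lemma bool_hom0 (G : zmodType) (f : G -> bool) : bool_hom f -> f 0 = false.
Proof. by move=> /(_ 0 0); rewrite addr0; case: (f 0). Qed.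

Lemma bool_hom_sum (G : zmodType) (f : G -> bool) (I : Type) (s : seq I)
    (F : I -> G) : bool_hom f ->
  f (\sum_(i <- s) F i) = \big[addb/false]_(i <- s) f (F i).
Proof. by move=> fh; apply: big_morph; [exact: fh|exact: bool_hom0]. Qed.

Section boolean_group.
Variable G : zmodType.
Hypothesis G2 : forall x : G, x + x = 0.

Lemma boolean_opp (x : G) : - x = x.
Proof. by apply: (addrI x); rewrite subrr G2. Qed.

Lemma boolean_addK (x y : G) : x + (x + y) = y.
Proof. by rewrite addrA G2 add0r. Qed.

(** Linear independence over the field with two elements, where a linear combination is a sum over a
    duplicate-free list. *)
Definition independent (B : set G) : Prop := forall s : seq G, uniq s ->
  (forall x, x \in s -> B x) -> \sum_(x <- s) x = 0 -> s = [::].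

Definition span (B : set G) : set G :=
  [set g | exists2 s : seq G, (forall x, x \in s -> B x) & g = \sum_(x <- s) x].

Lemma not_uniq_perm (T : eqType) (s : seq T) : ~~ uniq s ->
  exists x t, perm_eq s (x :: x :: t).
Proof.
elim: s => // x s IH /=; rewrite negb_and negbK => /orP[xs|/IH[y [t st]]].
  by exists x, (rem x s); rewrite perm_cons; exact: perm_to_rem.
exists y, (x :: t); apply: (@perm_trans _ (x :: y :: y :: t)).
  by rewrite perm_cons.
by rewrite -(perm_catCA [:: y; y] [:: x]).
Qed.

(** This makes linear extension from [B] well defined. Repeated entries cancel in pairs in both
    sums, until the list is duplicate-free and hence empty. *)
Lemma independent_big_addb (B : set G) (f : G -> bool) (s : seq G) :
  independent B -> (forall x, x \in s -> B x) -> \sum_(x <- s) x = 0 ->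
  \big[addb/false]_(x <- s) f x = false.
Proof.
move=> iB; have [n] := ubnP (size s); elim: n s => // n IH s sn sB s0.
have [us|/not_uniq_perm[x [t st]]] := boolP (uniq s).
  by rewrite (iB s us sB s0) big_nil.
rewrite (perm_big _ st) !big_cons /= addbA addbb addFb.
move: s0; rewrite (perm_big _ st) !big_cons /= boolean_addK => t0; apply: IH => //.
  by move: sn; rewrite (perm_size st) /= => /ltnW.
by move=> y yt; apply: sB; rewrite (perm_mem st) !inE yt !orbT.
Qed.

Lemma independent_hom (B : set G) (f : G -> bool) :
  independent B -> span B = setT ->
  exists2 phi, bool_hom phi & forall b, B b -> phi b = f b.
Proof.
move=> iB BT; have /choice[s sP] (g : G) : exists s : seq G,
    (forall x, x \in s -> B x) /\ g = \sum_(x <- s) x.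
  have : span B g by rewrite BT.
  by move=> [s sB gs]; exists s.
exists (fun g => \big[addb/false]_(x <- s g) f x) => [g h|b Bb].
  (* The chosen expansions of [g + h], [g] and [h] together sum to 0. *)
  have := @independent_big_addb B f (s (g + h) ++ s g ++ s h) iB.
  rewrite !big_cat /= -!(sP _).2 G2.
  set a := \big[_/_]_(_ <- s (g + h)) _; set b := \big[_/_]_(_ <- s g) _.
  set c := \big[_/_]_(_ <- s h) _ => abc.
  suff : a (+) (b (+) c) = false by case: (a); case: (b); case: (c).
  apply: abc => // x; rewrite !mem_cat => /or3P[] xs;
    [move: (sP (g + h))|move: (sP g)|move: (sP h)]; by case=> + _; exact.
have := @independent_big_addb B f (b :: s b) iB.
rewrite !big_cons /= -(sP b).2 G2.
set a := \big[_/_]_(_ <- s b) _ => ab.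
suff : f b (+) a = false by case: (a); case: (f b).
by apply: ab => // x; rewrite inE => /predU1P[->//|]; exact: (sP b).1.
Qed.

Definition independent_seq (x : nat -> G) : Prop := forall s : seq nat, uniq s ->
  \sum_(i <- s) x i = 0 -> s = [::].

Lemma independent_seq_inj (x : nat -> G) : independent_seq x -> injective x.
Proof.
move=> ix i j e; apply/eqP/negPn/negP => ij.
have := ix [:: i; j]; rewrite /= inE ij big_cons big_seq1 e G2.
by move=> /(_ isT erefl).
Qed.

Lemma map_preimage_seq (T : Type) (U : eqType) (f : T -> U) (s : seq U) :
  (forall u, u \in s -> exists t, f t = u) -> exists t, s = map f t.
Proof.
elim: s => [|u s IH] us; first by exists [::].
have [|t ->] := IH; first by move=> v vs; apply: us; rewrite inE vs orbT.
by have [w <-] := us u (mem_head _ _); exists (w :: t).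
Qed.

Lemma independent_range (x : nat -> G) : independent_seq x -> independent (range x).
Proof.
move=> ix s us sx s0; have [t st] : exists t, s = map x t.
  by apply: map_preimage_seq => u /sx[i _ <-]; exists i.
move: us s0; rewrite st big_map => /map_uniq ut t0.
by rewrite (ix t).
Qed.

Lemma independent_adjoin (B : set G) (y : G) : independent B -> ~ span B y ->
  independent (B `|` [set y]).
Proof.
move=> iB ny s us sB s0.
have rest (x : G) (t : seq G) : x \in t -> y \notin t -> {subset t <= s} -> B x.
  by move=> xt yt /(_ _ xt)/sB[//|xy]; rewrite -xy xt in yt.
have [ys|ys] := boolP (y \in s).
  case: ny; exists (rem y s).
    by move=> x xs; apply: (rest x (rem y s)) => //;
      [rewrite mem_rem_uniq // inE eqxx|exact: mem_rem].
  move: s0; rewrite (perm_big _ (perm_to_rem ys)) big_cons /= => s0.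
  by apply/eqP; rewrite -subr_eq0 boolean_opp s0.
by apply: iB => // x xs; apply: (rest x s).
Qed.

Lemma independent_basis (A : set G) : independent A ->
  exists B, [/\ A `<=` B, independent B & span B = setT].
Proof.
move=> iA.
have [B [iAB Bmax]] : exists B, independent (A `|` B) /\
    forall C, B `<` C -> ~ independent (A `|` C).
  (* Zorn's lemma is applied to the part added to [A], so that the empty chain is covered by the
     independence of [A]. *)
  apply: (@Zorn_bigcup _ [set B | independent (A `|` B)]) => C CP Ctot s us sC s0.
  have [sA|] := pselect (forall x, x \in s -> A x); first exact: iA.
  move=> nsA; have [F CF sF] : exists2 F, C F & forall x, x \in s -> (A `|` F) x.
    have [F0 CF0] : exists F, C F.
      move/existsNP: nsA => [x /not_implyP[/sC[//|[F CF _]] _]]; by exists F.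
    elim: s {us s0 nsA} sC => [|x s IH] sC; first by exists F0.
    have [|F CF sF] := IH; first by move=> y ys; apply: sC; rewrite inE ys orbT.
    have [Ax|[F' CF' F'x]] := sC x (mem_head _ _).
      by exists F => // y; rewrite inE => /predU1P[->|/sF//]; left.
    have [FF'|F'F] := Ctot _ _ CF CF'.
      exists F' => // y; rewrite inE => /predU1P[->|/sF[Ay|/FF' F'y]]; last by right.
        by right.
      by left.
    exists F => // y; rewrite inE => /predU1P[->|/sF//]; right; exact: F'F.
  by apply: (CP _ CF).
exists (A `|` B); split=> [x Ax|//|]; first by left.
rewrite -subTset => g _; apply: contrapT => ng.
apply: (Bmax (B `|` [set g])).
  split; first by move=> x; left.
  move=> /(_ g (or_intror erefl)) Bg; apply: ng; exists [:: g].
    by move=> x; rewrite inE => /eqP ->; right.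
  by rewrite big_seq1.
by rewrite setUA; exact: independent_adjoin.
Qed.

Lemma hom_extension (A : set G) (f : G -> bool) : independent A ->
  exists2 phi, bool_hom phi & forall a, A a -> phi a = f a.
Proof.
move=> /independent_basis[B [AB iB BT]].
have [phi phih phif] := independent_hom f iB BT.
by exists phi => // a /AB; exact: phif.
Qed.

Lemma independent_seq_hom (x : nat -> G) (v : nat -> bool) : independent_seq x ->
  exists2 phi, bool_hom phi & forall n, phi (x n) = v n.
Proof.
move=> ix; have xi := independent_seq_inj ix.
have [f fP] : exists f : G -> bool, forall n, f (x n) = v n.
  exists (fun g => `[< exists2 n, x n = g & v n >]) => n.
  by apply/asboolP/idP => [[m /xi <-]|vn] //; exists n.
have [phi phih phif] := hom_extension f (independent_range ix).
by exists phi => // n; rewrite phif ?fP //; exists n.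
Qed.

Lemma hom_separates (g : G) : g != 0 -> exists2 phi, bool_hom phi & phi g.
Proof.
move=> g0; have ig : independent [set g].
  have -> : [set g] = set0 `|` [set g] by rewrite set0U.
  apply: independent_adjoin.
    by case=> [|x s] // _ /(_ x (mem_head _ _)).
  move=> [[|x s] s0 gs]; last by case: (s0 x (mem_head _ _)).
  by rewrite gs big_nil eqxx in g0.
have [phi phih phig] := hom_extension (fun=> true) ig.
by exists phi => //; exact: phig.
Qed.

(* The finite set is nonempty when y is a finite sum of terms of x: phi vanishes at y
   and, among the terms of x, only at those of that sum. *)
Lemma independent_seq_isolated (x : nat -> G) (y : G) : independent_seq x ->
  exists2 phi, bool_hom phi & finite_set [set n | phi (x n) = phi y].
Proof.
move=> ix; have [[s sx ys]|ny] := pselect (span (range x) y); last first.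
  have [phi phih phix] := hom_extension (fun g => `[< g = y >])
    (independent_adjoin (independent_range ix) ny).
  exists phi => //; suff -> : [set n | phi (x n) = phi y] = set0 by exact: finite_set0.
  rewrite -subset0 => n /=; rewrite !phix; [|by right|by left; exists n].
  rewrite [RHS]asboolT // => /asboolP xy; apply: ny; exists [:: y].
    by move=> z; rewrite inE => /eqP ->; exists n.
  by rewrite big_seq1.
have [t st] : exists t, s = map x t.
  by apply: map_preimage_seq => u /sx[i _ <-]; exists i.
have [phi phih phix] := independent_seq_hom (fun n => n \notin t) ix.
exists phi => //; apply: (sub_finite_set _ (finite_seq t)) => n /=.
rewrite phix ys bool_hom_sum // st big_map big_seq big1; first by case: (n \in t).
by move=> i it; rewrite phix it.
Qed.

Lemma finite_span (s : seq G) : finite_set (span [set` s]).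
Proof.
elim: s => [|x s IH].
  apply: (sub_finite_set _ (finite_set1 (0 : G))) => g [[|y t] ty ->].
    by rewrite big_nil.
  by have := ty y (mem_head _ _).
apply: (sub_finite_set (B := span [set` s] `|` [set x + g | g in span [set` s]])).
  move=> g [t tx ->]; elim: t tx => [|y t IHt] tx.
    by left; exists [::]; rewrite ?big_nil.
  have := tx y (mem_head _ _); rewrite /= inE big_cons.
  have [|[u us ->]|[_ [u us ->] <-]] := IHt.
  - by move=> z zt; apply: tx; rewrite inE zt orbT.
  - move=> /predU1P[->|ys]; first by right; exists (\sum_(i <- u) i) => //; exists u.
    left; exists (y :: u); last by rewrite big_cons.
    by move=> z; rewrite inE => /predU1P[->//|/us].
  - move=> /predU1P[->|ys]; first by left; exists u => //; rewrite boolean_addK.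
    right; exists (\sum_(i <- y :: u) i); last by rewrite big_cons addrCA.
    by exists (y :: u) => // z; rewrite inE => /predU1P[->//|/us].
by rewrite finite_setU; split => //; exact: finite_image.
Qed.

(** Each term is chosen outside the span of the earlier ones, which is finite. In a relation, the
    term of greatest index would lie in that span. *)
Lemma infinite_independent_seq (A : set G) : infinite_set A ->
  exists2 x : nat -> G, independent_seq x & forall n, A (x n).
Proof.
move=> Ainf; have /choice[next nextP] (s : seq G) : exists g, A g /\ ~ span [set` s] g.
  apply: contrapT => /forallNP ng; apply: Ainf.
  apply: (sub_finite_set _ (finite_span s)) => g Ag.
  by apply: contrapT => sg; apply: (ng g).
pose fix l n := if n is m.+1 then next (l m) :: l m else [::].
have lP m n : (m < n)%N -> next (l m) \in l n.
  elim: n => // n IH; rewrite ltnS leq_eqVlt => /predU1P[->|/IH mn].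
    exact: mem_head.
  by rewrite inE mn orbT.
exists (fun n => next (l n)) => [s us s0|n]; last by case: (nextP (l n)).
case: s us s0 => // i0 s0; set s := i0 :: s0 => us ss0; exfalso.
have [m ms mmax] : exists2 m, m \in s & forall i, i \in s -> (i <= m)%N.
  have [||m ms mmax] := @ex_maxnP (fun i => i \in s) (\max_(i <- s) i).
  - by exists i0; exact: mem_head.
  - by move=> i si; exact: (@leq_bigmax_seq _ _ predT id).
  by exists m.
apply: (nextP (l m)).2; exists [seq next (l i) | i <- rem m s].
  move=> _ /mapP[i + ->] /=; rewrite mem_rem_uniq // inE => /andP[im si].
  by apply: lP; rewrite ltn_neqAle im mmax.
move: ss0; rewrite (perm_big _ (perm_to_rem ms)) big_cons /= => e.
by apply/eqP; rewrite big_map -subr_eq0 boolean_opp e.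
Qed.

(** The homomorphism belonging to the least index in a relation takes the value 1 on the sum. *)
Lemma triangular_independent_seq (chi : nat -> G -> bool) (x : nat -> G) :
  (forall n, bool_hom (chi n)) -> (forall n, chi n (x n)) ->
  (forall m n, (m < n)%N -> chi m (x n) = false) -> independent_seq x.
Proof.
move=> chih chi1 chi0 s us s0; apply: contrapT => sn.
have [m ms mmin] : exists2 m, m \in s & forall i, i \in s -> (m <= i)%N.
  have [|m ms mmin] := @ex_minnP (fun i => i \in s); last by exists m.
  by case: (s) sn => // i t _; exists i; exact: mem_head.
have := bool_hom0 (chih m); rewrite -s0 bool_hom_sum // (bigD1_seq m) //= chi1.
rewrite big_seq_cond big1 // => i /andP[si im]; apply: chi0.
by rewrite ltn_neqAle eq_sym im mmin.
Qed.

(** Duality in finite codimension: a functional that vanishes on the common kernel of finitely many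
    others is a sum of them. If [phi] does not yet vanish on the kernel of the tail, adding [chi j]
    makes it do so. *)
Lemma hom_finite_kernel (J : Type) (chi : J -> G -> bool) (s : seq J)
    (phi : G -> bool) :
  (forall j, bool_hom (chi j)) -> bool_hom phi ->
  (forall g, (all (fun j => ~~ chi j g) s) -> phi g = false) ->
  exists t : seq J, forall g, phi g = \big[addb/false]_(j <- t) chi j g.
Proof.
move=> chih; elim: s phi => [|j s IH] phi phih phi0.
  by exists [::] => g; rewrite big_nil phi0.
have [H|/existsNP[g0 /not_implyP[sg0 /eqP]]] :=
  pselect (forall g, all (fun j => ~~ chi j g) s -> phi g = false).
  exact: IH.
rewrite eqbF_neg negbK => phig0.
have jg0 : chi j g0.
  by apply/negPn/negP => nj; move: phig0; rewrite phi0 //= nj.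
have [|g sg|t tP] := IH (fun g => phi g (+) chi j g).
- by move=> g h; rewrite phih chih addbACA.
- have [jg|jg] := boolP (chi j g); last by rewrite addbF phi0 //= jg.
  rewrite addbT; have := phi0 (g + g0); rewrite phih phig0 addbT /=; apply.
  rewrite chih jg jg0 /=.
  have := conj sg sg0 => /andP; rewrite -all_predI; apply: sub_all => i /andP[].
  by rewrite chih => /= /negbTE-> /negbTE->.
by exists (j :: t) => g; rewrite big_cons -tP addbC -addbA addbb addbF.
Qed.

End boolean_group.

Lemma inj_le_seq (T : Type) : nat <~ T -> seq T <~ T.
Proof.
move=> nT; have TT := inj_le_square nT; have [k ki] := TT; have [i ii] := nT.
apply: (@inj_le_trans (nat * T)); last first.
  exact: (inj_le_trans (inj_le_prod nT (inj_le_refl _)) TT).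
pose enc := foldr (fun x a => k (x, a)) (i 0%N).
exists (fun s => (size s, enc s)) => s t.
elim: s t => [|x s IH] [|y t] //= [st /ki[-> e]].
by congr (_ :: _); apply: IH; rewrite st e.
Qed.

Lemma inj_le_sum (A B T : Type) : nat <~ T -> A <~ T -> B <~ T -> (A + B)%type <~ T.
Proof.
move=> nT [f fi] [g gi]; apply: (inj_le_trans _ (inj_le_square nT)).
have [i ii] := nT.
exists (fun x => match x with inl a => (i 0%N, f a) | inr b => (i 1%N, g b) end).
by move=> [a|b] [a'|b'] [] => [/fi->|/ii|/ii|/gi->].
Qed.

(** A basis extending an independent sequence is infinite, so it is as large as the set of its
    finite lists, which maps onto [G]. *)
Lemma boolean_basis_card (G : zmodType) : (forall x : G, x + x = 0) -> nat <~ G ->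
  exists B : set G, [/\ independent B, span B = setT & G <~ B].
Proof.
move=> G2 /infinite_inj_le nG; have [x ix _] := infinite_independent_seq G2 nG.
have [B [xB iB BT]] := independent_basis G2 (independent_range ix).
exists B; split=> //; apply: (@inj_le_trans (seq B)); last first.
  apply: inj_le_seq; exists (fun n => SigSub (mem_set (xB _ (ex_intro2 _ _ n I erefl)))).
  by move=> m n [] /(independent_seq_inj G2 ix).
apply: (@inj_le_surj _ _ (fun s => \sum_(b <- map val s) b)) => g.
have [s sB ->] : span B g by rewrite BT.
have [|t ->] := @map_preimage_seq B G val s; last by exists t.
by move=> u /sB Bu; exists (SigSub (mem_set Bu)).
Qed.

(** * Characters interpolating on countable sets *)

(** Countably many test points of [X], countably many patterns of values at them, and an output bit
    for each pattern. *)
Definition partial_code (X : Type) : Type :=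
  ((nat -> X) * (nat -> nat -> bool) * (nat -> bool))%type.

Definition decode (X : Type) (c : partial_code X) (y : X -> bool) : bool :=
  `[< exists2 n, c.1.2 n = y \o c.1.1 & c.2 n >].

(** A countable version of Hausdorff's independent families: with one test point for each pair of
    distinct [y m] and [y n], the patterns determine the [y n]. *)
Lemma decode_interpolation (X : Type) (x0 : X) (y : nat -> X -> bool)
    (f : (X -> bool) -> bool) : exists c, forall n, decode c (y n) = f (y n).
Proof.
have [k kP] := surj_inj_le (0, 0)%N inj_le_nat2.
have /choice[A AP] n : exists x, y (k n).1 x = y (k n).2 x -> y (k n).1 = y (k n).2.
  have [|/existsNP[x nx]] := pselect (forall x, y (k n).1 x = y (k n).2 x).
    by move=> /funext e; exists x0.
  by exists x.
exists (A, fun n => y n \o A, fun n => f (y n)) => n.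
apply/asboolP/idP => [[m /= mn fm]|fn]; last by exists n.
have [p pmn] := kP (m, n); have := AP p; rewrite pmn /=.
by move=> <- //; exact: (congr1 (fun h => h p) mn).
Qed.

Lemma injective_interpolation (J X : Type) (x0 : X) (y : J -> X -> bool)
    (j : nat -> J) (f : J -> bool) : injective y ->
  exists c, forall n, decode c (y (j n)) = f (j n).
Proof.
move=> yi; have [c cP] := decode_interpolation x0 (y \o j)
  (fun z => `[< exists2 i, y i = z & f i >]).
exists c => n; rewrite cP /=; apply/asboolP/idP => [[i /yi <-]//|fj].
by exists (j n).
Qed.

Lemma cantor_avoid (q : nat -> nat -> nat -> bool) :
  exists r : nat -> bool, forall m n, q m n <> r.
Proof.
have [k kP] := surj_inj_le (0, 0)%N inj_le_nat2.
exists (fun p => ~~ q (k p).1 (k p).2 p) => m n e.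
have [p pmn] := kP (m, n); have := congr1 (fun h => h p) e; rewrite /= pmn /=.
by case: (q m n p).
Qed.

(* A column j = (q, c) decodes the row b by c when the tag (rho b).1 is one of the
   countably many tags in q; otherwise the row b decodes the column by (rho b).2. The
   first rule interpolates on countably many rows; given countably many columns, some
   tag avoids all their lists, and there the second rule interpolates. *)
Lemma independent_matrix (B T : Type) : nat <~ T -> (nat -> T) <~ B ->
  B <~ set (set T) -> exists (J : choiceType) (M : B -> J -> bool),
  (forall (j : nat -> J) f, exists b, forall n, M b (j n) = f (j n)) /\
  (forall (b : nat -> B) f, exists j, forall n, M (b n) j = f (b n)).
Proof.
move=> nT TB BT.
have [i ii] := nT.
pose X := T -> bool.
have [y yi] : B <~ (X -> bool).
  apply: (inj_le_trans BT); apply: (inj_le_trans (inj_le_set_bool _)).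
  exact: (inj_le_dom true (inj_le_set_bool T)).
pose J := ((nat -> nat -> bool) * partial_code X)%type.
(* [W] indexes the bits that make up a column. It embeds in [T], so the codes for decoding columns
   embed in [nat -> T] and hence in [B]. *)
pose W := ((nat * nat) + (nat * T) + (nat * nat) + nat)%type.
pose e (j : J) (w : W) : bool := match w with
  | inl (inl (inl (m, n))) => j.1 m n
  | inl (inl (inr (m, t))) => j.2.1.1 m t
  | inl (inr (m, n)) => j.2.1.2 m n
  | inr n => j.2.2 n
  end.
have ei : injective e.
  move=> [q [[A s] v]] [q' [[A' s'] v']] E.
  have -> : q = q'.
    apply/funext => m; apply/funext => n.
    exact: (congr1 (fun h => h (inl (inl (inl (m, n))))) E).
  have -> : A = A'.
    apply/funext => m; apply/funext => n.
    exact: (congr1 (fun h => h (inl (inl (inr (m, n))))) E).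
  have -> : s = s'.
    apply/funext => m; apply/funext => n.
    exact: (congr1 (fun h => h (inl (inr (m, n)))) E).
  have -> // : v = v'.
  by apply/funext => n; exact: (congr1 (fun h => h (inr n)) E).
have TT := inj_le_square nT.
have nnT : (nat * nat)%type <~ T by exact: inj_le_trans inj_le_nat2 nT.
have WT : W <~ T.
  do 3 apply: inj_le_sum => //.
  exact: (inj_le_trans (inj_le_prod nT (inj_le_refl _)) TT).
have QQ : ((nat -> T) * (nat -> T))%type <~ (nat -> T).
  apply: (@inj_le_trans (nat -> T * T)); last exact: inj_le_codom.
  exists (fun p n => (p.1 n, p.2 n)) => -[a b] [a' b'] E.
  by congr (_, _); apply/funext => n; have [] := congr1 (fun h => h n) E.
have cQ : (nat -> bool) <~ (nat -> T).
  apply: inj_le_codom; exists (fun b : bool => i b) => b b' /ii.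
  by case: b; case: b'.
have ccQ : (nat -> nat -> bool) <~ (nat -> T).
  apply: inj_le_trans cQ; apply: (inj_le_trans (inj_le_curry _ _ _)).
  exact: (inj_le_dom true inj_le_nat2).
have DB : ((nat -> bool) * partial_code W)%type <~ B.
  apply: inj_le_trans TB; apply: (inj_le_trans (inj_le_prod cQ _) QQ).
  apply: (inj_le_trans (inj_le_prod _ cQ) QQ).
  exact: (inj_le_trans (inj_le_prod (inj_le_codom _ WT) ccQ) QQ).
have [rho rhoP] := 
  surj_inj_le (fun=> true, (fun=> inr 0%N, fun=> fun=> true, fun=> true)) DB.
exists J, (fun b j => if `[< exists n, j.1 n = (rho b).1 >] then decode j.2 (y b)
  else decode (rho b).2 (e j)); split=> [j f|b f].
  have [c cP] := injective_interpolation (inr 0%N) j f ei.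
  have [r rP] := cantor_avoid (fun n => (j n).1).
  have [b bP] := rhoP (r, c); exists b => n; rewrite bP /=.
  by case: asboolP => [[m /rP]|].
have [c cP] := injective_interpolation (fun=> true) b f yi.
exists (fun n => (rho (b n)).1, c) => n /=.
by case: asboolP => [//|[]]; exists n.
Qed.

(** The matrix prescribes the homomorphisms on a basis. For the last property, [phi] has to be
    matched only at the countably many basis elements in expansions of the [x n]. *)
Lemma boolean_characters (G : zmodType) (T : Type) :
  (forall x : G, x + x = 0) -> nat <~ T -> (nat -> T) <~ G -> G <~ set (set T) ->
  exists (J : choiceType) (chi : J -> G -> bool),
  [/\ forall j, bool_hom (chi j),
      forall (j : nat -> J) f, exists g, forall n, chi (j n) g = f (j n)
    & forall (phi : G -> bool) (x : nat -> G), bool_hom phi ->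
        exists j, forall n, chi j (x n) = phi (x n)].
Proof.
move=> G2 nT TG GT.
have nG : nat <~ G.
  apply: inj_le_trans TG; have [i ii] := nT; exists (fun n _ => i n) => m n.
  by move=> /(congr1 (fun h => h 0%N))/ii.
have [B [iB BT GB]] := boolean_basis_card G2 nG.
have [|||J [M [row col]]] := @independent_matrix B T.
- exact: nT.
- exact: inj_le_trans TG GB.
- exact: inj_le_trans (inj_le_set_type _) GT.
have /choice[chi chiP] (j : J) : exists phi : G -> bool, bool_hom phi /\
    forall b : B, phi (val b) = M b j.
  have [phi phih phiM] := 
    independent_hom G2 (fun g => `[< exists2 b : B, val b = g & M b j >]) iB BT.
  exists phi; split=> // b; rewrite phiM; last exact: (set_mem (valP b)).
  by apply/asboolP/idP => [[c /val_inj <-//]|Mb]; exists b.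
exists J, chi; split=> [j|j f|phi x phih].
- exact: (chiP j).1.
- by have [b bP] := row j f; exists (val b) => n; rewrite (chiP _).2.
have /choice[s sP] n : exists s : seq B, x n = \sum_(b <- s) val b.
  have [s sB ->] : span B (x n) by rewrite BT.
  have [|t ->] := @map_preimage_seq B G val s; last by exists t; rewrite big_map.
  by move=> u /sB Bu; exists (SigSub (mem_set Bu)).
have [b0 _] : exists b : B, True by have [h _] := GB; exists (h 0).
have [k kP] := surj_inj_le (0, 0)%N inj_le_nat2.
have [j jP] := col (fun p => nth b0 (s (k p).1) (k p).2) (fun b => phi (val b)).
exists j => n; rewrite sP !bool_hom_sum //; last exact: (chiP j).1.
apply: eq_big_seq => b bs; rewrite (chiP j).2.
have [p pP] := kP (n, index b (s n)).
by have := jP p; rewrite pP /= nth_index.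
Qed.

(** * The topology of a family of characters *)

Section character_topology.
Variables (G : zmodType) (J : choiceType) (chi : J -> G -> bool).
Hypothesis chih : forall j, bool_hom (chi j).

Definition agree (s : seq J) (x y : G) : Prop :=
  forall j, j \in s -> chi j y = chi j x.

Definition character_open : set_system G :=
  [set O | forall x, O x -> exists s, forall y, agree s x y -> O y].

Fact character_openT : character_open setT.
Proof. by move=> x _; exists [::]. Qed.

Fact character_openI : setI_closed character_open.
Proof.
move=> A B oA oB x [/oA[s sA] /oB[t tB]]; exists (s ++ t) => y xy; split.
  by apply: sA => j js; apply: xy; rewrite mem_cat js.
by apply: tB => j jt; apply: xy; rewrite mem_cat jt orbT.
Qed.

Fact character_open_bigU (I : Type) (f : I -> set G) :
  (forall i, character_open (f i)) -> character_open (\bigcup_i f i).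
Proof.
by move=> fo x [i _ /(fo i)[s sf]]; exists s => y /sf ?; exists i.
Qed.

Lemma bool_hom_opp (f : G -> bool) x : bool_hom f -> f (- x) = f x.
Proof.
by move=> fh; have := bool_hom0 fh; rewrite -(subrr x) fh; case: (f x); case: (f (- x)).
Qed.

Lemma agree_open s x : character_open (agree s x).
Proof. by move=> y xy; exists s => z yz j js; rewrite yz ?xy. Qed.

Fact character_sub_continuous (x y : G) (O : set G) :
  character_open O -> O (x - y) -> exists A B : set G,
  [/\ character_open A, character_open B, A x, B y &
      forall a b, A a -> B b -> O (a - b)].
Proof.
move=> oO /oO[s sO]; exists (agree s x), (agree s y); split => //.
- exact: agree_open.
- exact: agree_open.
move=> a b xa yb; apply: sO => j js.
by rewrite !chih !bool_hom_opp // xa ?yb.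
Qed.

Definition character_topology : group_topology G :=
  GroupTopology character_openT character_openI character_open_bigU
    character_sub_continuous.

Local Notation X := (with_topology character_topology).

Lemma character_nbhs (x : X) (A : set X) :
  nbhs x A <-> exists s, forall y, agree s x y -> A y.
Proof.
split=> [|[s sA]].
  rewrite nbhsE => -[W [oW Wx] WA]; have [s sW] := oW x Wx.
  by exists s => y /sW/WA.
apply: (@filterS _ _ _ (agree s x)) => //; apply: open_nbhs_nbhs; split => //.
exact: agree_open.
Qed.

Lemma agree_nbhs s (x : X) : nbhs x (agree s x).
Proof. by apply/character_nbhs; exists s. Qed.

Hypothesis G2 : forall x : G, x + x = 0.
Hypothesis row : forall (j : nat -> J) f, exists g, forall n, chi (j n) g = f (j n).
Hypothesis col : forall (phi : G -> bool) (x : nat -> G), bool_hom phi ->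
  exists j, forall n, chi j (x n) = phi (x n).

Lemma character_separates (x y : G) : x != y -> exists j, chi j x != chi j y.
Proof.
rewrite -subr_eq0 => /(hom_separates G2)[phi phih phixy].
have [j jP] := col (fun=> x - y) phih; exists j.
have := jP 0%N; rewrite phixy chih bool_hom_opp //.
by case: (chi j x); case: (chi j y).
Qed.

Lemma character_hausdorff : hausdorff_space X.
Proof.
move=> x y xy; apply/eqP/negPn/negP => /character_separates[j /eqP]; apply.
have [z [zx zy]] := xy _ _ (agree_nbhs [:: j] x) (agree_nbhs [:: j] y).
by rewrite -(zx j) ?(zy j) ?mem_head.
Qed.

Lemma character_interpolation (j0 : J) (S : nat -> seq J) (f : J -> bool) :
  exists g, forall n j, j \in S n -> chi j g = f j.
Proof.
have [k kP] := surj_inj_le (0, 0)%N inj_le_nat2.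
have [g gP] := row (fun p => nth j0 (S (k p).1) (k p).2) f.
exists g => n j jS; have [p pP] := kP (n, index j (S n)).
by have := gP p; rewrite pP /= nth_index.
Qed.

(* The point g realises on countably many characters the limit of the x n along
   an ultrafilter; the values on further characters can be adjusted freely. *)
Lemma character_pseudocompact (R : realType) (j0 : J) : pseudocompact R X.
Proof.
move=> f cf; apply: contrapT => fub.
have /choice[x xP] (n : nat) : exists x : X, n%:R < `|f x|.
  apply: contrapT => /forallNP nx; apply: fub.
  exists n%:R; split => // M nM y _ /=; apply: le_trans (ltW nM).
  by rewrite leNgt; apply/negP/nx.
have /choice[S SP] n : exists S : seq J, forall y, agree S (x n) y -> n%:R < `|f y|.
  apply/(@character_nbhs (x n)).
  have /cf : nbhs (f (x n)) [set t | n%:R < `|t|].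
    apply: open_nbhs_nbhs; split; last exact: xP.
    have -> : [set t : R | n%:R < `|t|] = Num.norm @^-1` [set t | n%:R < t] by [].
    by apply: open_comp; [move=> t _; exact: norm_continuous|exact: open_gt].
  by [].
have [U [UU Uoo]] := ultraFilterLemma eventually_filter.
have [g gP] := character_interpolation j0 S (fun j => `[< U [set n | chi j (x n)] >]).
have gU n j : j \in S n -> U [set m | chi j (x m) = chi j g].
  move=> jS; rewrite (gP n j jS).
  have [Uj|nUj] := pselect (U [set m | chi j (x m)]).
    by rewrite asboolT //; apply: filterS Uj => m /= ->.
  rewrite asboolF //; have [//|Ujc] := in_ultra_setVsetC [set m | chi j (x m)] UU.
  by apply: filterS Ujc => m /= /negP/negbTE.
have /cf/character_nbhs[s sP] : nbhs (f g) [set t | `|t| < `|f g| + 1].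
  apply: open_nbhs_nbhs; split; last by rewrite /= ltrDl.
  have -> : [set t : R | `|t| < `|f g| + 1]
    = Num.norm @^-1` [set t | t < `|f g| + 1] by [].
  by apply: open_comp; [move=> t _; exact: norm_continuous|exact: open_lt].
(* Only the indices that occur in some [S n] are known to converge along [U] to the values at
   [g]. *)
have Us : U [set m | forall j, j \in s -> (exists n, j \in S n) ->
    chi j (x m) = chi j g].
  elim: s {sP} => [|j s IH]; first by apply: filterS filterT => m _ j.
  have Uj : U [set m | (exists n, j \in S n) -> chi j (x m) = chi j g].
    have [[n jS]|nj] := pselect (exists n, j \in S n).
      by apply: filterS (gU n j jS) => m + _.
    by apply: filterS filterT => m _ /nj.
  by apply: filterS (filterI Uj IH) => m [mj ms] i; rewrite inE => /predU1P[->|/ms].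
have [N NP] : exists N : nat, `|f g| + 1 <= N%:R.
  exists `|Num.ceil (`|f g| + 1)|%N; apply: le_trans (ceil_ge _) _.
  by rewrite natr_absz ler_int ler_norm.
have [m [mP Nm]] : exists m, (forall j, j \in s -> (exists n, j \in S n) ->
    chi j (x m) = chi j g) /\ (N <= m)%N.
  by apply: (@filter_ex _ U); apply: filterI => //; apply: Uoo; exists N.
(* The point [z] is close both to [x m] and to [g]; by [mP] the two demands agree on common indices.
   The bounds on [f z] then conflict, as [m] is at least [|f g| + 1]. *)
have [z zP] := character_interpolation j0 (fun=> S m ++ s)
  (fun j => if j \in S m then chi j (x m) else chi j g).
have zm : agree (S m) (x m) z.
  by move=> j jS; rewrite (zP 0%N) ?jS // mem_cat jS.
have zg : agree s g z.
  move=> j js; rewrite (zP 0%N) ?mem_cat ?js ?orbT //.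
  by case: ifP => // jS; apply: mP => //; exists m.
have := lt_trans (SP m z zm) (sP z zg); apply/negP; rewrite -leNgt.
by apply: le_trans NP _; rewrite ler_nat.
Qed.

End character_topology.

(** The restriction of any homomorphism to Z/2, continuous or not, to a countable set is continuous.
    This form of interpolation is shared by the group and its dual. *)
Definition hom_local (X : PreTopologicalZmodule.type) : Prop :=
  forall phi : X -> bool, bool_hom phi -> forall (x : nat -> X) (y : X),
  exists2 V, nbhs y V & forall n, V (x n) -> phi (x n) = phi y.

Section hom_local.
Variable X : PreTopologicalZmodule.type.
Hypotheses (X2 : forall x : X, x + x = 0) (Xloc : hom_local X).

(** Some homomorphism takes its value at [y] on only finitely many terms, so a neighbourhood on
    which it is constant along the sequence meets only these. *)
Lemma hom_local_not_accumulation (x : nat -> X) (y : X) :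
  independent_seq x -> ~ accumulation_point x y.
Proof.
move=> ix xy; have [phi phih fin] := independent_seq_isolated X2 y ix.
have [V yV VP] := Xloc phih x y.
apply: (xy V yV); apply: sub_finite_set fin => n; exact: VP.
Qed.

Lemma hom_local_compact_finite (K : set X) : compact K -> finite_set K.
Proof.
move=> cK; apply: contrapT => /(infinite_independent_seq X2)[x ix Kx].
have [|y [_ yx]] := cK (x @ \oo) _; first by exists 0%N => // n _; exact: Kx.
apply: (hom_local_not_accumulation ix (y := y)) => V yV.
apply: infinite_unbounded => N.
have [|_ [[n Nn <-] Vxn]] := yx [set x n | n in [set n | (N <= n)%N]] V _ yV.
  by exists N => // n Nn; exists n.
by exists n.
Qed.

End hom_local.

Section character_topology_properties.
Variables (G : zmodType) (J : choiceType) (chi : J -> G -> bool).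
Hypothesis chih : forall j, bool_hom (chi j).
Hypothesis G2 : forall x : G, x + x = 0.
Hypothesis Ginf : infinite_set [set: G].
Hypothesis row : forall (j : nat -> J) f, exists g, forall n, chi (j n) g = f (j n).
Hypothesis col : forall (phi : G -> bool) (x : nat -> G), bool_hom phi ->
  exists j, forall n, chi j (x n) = phi (x n).

Local Notation X := (with_topology (character_topology chih)).

Lemma character_hom_local : hom_local X.
Proof.
(* The point [y] is put in front of the sequence, so that one character matches [phi] there too. *)
move=> phi phih x y; have [j jP] := col (fun n => if n is m.+1 then x m else y) phih.
exists (agree chi [:: j] y); first exact: (agree_nbhs [:: j] y).
move=> n /(_ j (mem_head _ _)) e.
by have := jP n.+1; have := jP 0%N; rewrite /= e => -> ->.
Qed.

(** Characters dual to an independent sequence are pairwise distinct. *)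
Lemma character_infinite : nat <~ J.
Proof.
have [x ix _] := infinite_independent_seq G2 Ginf.
have /choice[j jP] (n : nat) : exists j, forall m, chi j (x m) = (m == n).
  have [phi phih phix] := independent_seq_hom G2 (fun m => m == n) ix.
  by have [j jP] := col x phih; exists j => m; rewrite jP.
exists j => m n e; have := jP m m; rewrite e jP eqxx => /eqP; exact.
Qed.

Lemma character_not_selectively_pseudocompact : ~ selectively_pseudocompact X.
Proof.
have [j ji] := character_infinite.
pose U n : set X := [set x | chi (j n) x /\ forall m, (m < n)%N -> chi (j m) x = false].
move=> /(_ U)[n|x xU [y]].
  split.
    move=> x [xn xm]; exists [seq j m | m <- iota 0 n.+1] => z xz.
    have jz m : (m <= n)%N -> chi (j m) z = chi (j m) x.
      by move=> mn; apply: xz; apply: map_f; rewrite mem_iota.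
    by split=> [|m mn]; [rewrite jz|rewrite (jz m (ltnW mn)) xm].
  have [g gP] := row j (fun i => i == j n); exists g; split.
    by rewrite gP eqxx.
  move=> m mn; rewrite gP; apply/negbTE/eqP => /ji e.
  by rewrite e ltnn in mn.
suff ix : independent_seq (x : nat -> G).
  exact: (@hom_local_not_accumulation X G2 character_hom_local x y ix).
apply: (@triangular_independent_seq _ (fun n => chi (j n))) => //.
- by move=> n; have [] := xU n.
- by move=> m n mn; have [_] := xU n; exact.
Qed.

Lemma character_compact_finite (K : set X) : compact K -> finite_set K.
Proof. by apply: hom_local_compact_finite; [exact: G2|exact: character_hom_local]. Qed.

End character_topology_properties.

(** * Duality *)

Section circle_two_torsion.
Local Open Scope complex_scope.
Variable R : realType.
Local Notation T := (circle R).

Fact circle_minus1_subproof : `|(-1 : R[i])| == 1.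
Proof. by rewrite normrN1. Qed.

(** The embedding of Z/2 in the circle, inverted on its image by the test [z != 0]; here [0] is the
    complex number 1. *)
Definition circle_sign (b : bool) : T :=
  if b then Circle circle_minus1_subproof else 0.

Lemma circle_signD a b : circle_sign (a (+) b) = circle_sign a + circle_sign b.
Proof.
case: a b => -[] /=; rewrite ?add0r ?addr0 //.
by apply: val_inj; rewrite /= mulrNN mulr1.
Qed.

Lemma circle_sign_neq0 b : (circle_sign b != 0) = b.
Proof.
case: b => /=; last by rewrite eqxx.
apply/eqP => /(congr1 val) /= /eqP; rewrite eq_sym -subr_eq0 opprK.
by rewrite -(natrD _ 1 1) pnatr_eq0.
Qed.

Lemma circle_sign_inj : injective circle_sign.
Proof. by move=> a b e; rewrite -(circle_sign_neq0 a) e circle_sign_neq0. Qed.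

Lemma circle_two_torsion (z : T) : z + z = 0 -> z = circle_sign (z != 0).
Proof.
move=> /(congr1 val) /= /eqP; rewrite -expr2 sqrf_eq1 => /orP[]/eqP z1.
  have -> : z = circle_sign false by apply: val_inj.
  by rewrite circle_sign_neq0.
have -> : z = circle_sign true by apply: val_inj.
by rewrite circle_sign_neq0.
Qed.

Lemma circle_punctured_open (z : T) : open [set w : T | w != z].
Proof.
have -> : [set w : T | w != z]
    = (fun w : T => (w : R[i]^o)) @^-1` (~` [set (z : R[i]^o)]).
  apply/seteqP; split=> w /=; first by move=> /eqP wz /val_inj.
  by move=> wz; apply/eqP => e; apply: wz; rewrite e.
apply: open_comp; first by move=> w _; exact: circle_val_continuous.
rewrite openC; apply: accessible_closed_set1; apply: hausdorff_accessible.
exact: norm_hausdorff.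
Qed.

End circle_two_torsion.

Lemma additive_circle_bool_hom (R : realType) (V : zmodType) (f : V -> circle R) :
  (forall x : V, x + x = 0) -> {morph f : x y / x + y} ->
  bool_hom (fun x => f x != 0) /\ forall x, f x = circle_sign R (f x != 0).
Proof.
move=> V2 fD; have f0 : f 0 = 0 by apply: (addrI (f 0)); rewrite -fD !addr0.
have fE x : f x = circle_sign R (f x != 0).
  by apply: circle_two_torsion; rewrite -fD V2.
split=> // x y; rewrite -(circle_sign_neq0 R (_ (+) _)) circle_signD -!fE.
by rewrite fD.
Qed.

Section dual.
Variables (R : realType) (X : PreTopologicalZmodule.type).
Hypothesis X2 : forall x : X, x + x = 0.
Local Notation D := (pontryagin_dual R X).

Lemma dual_additive (h : D) : {morph h : x y / x + y}.
Proof. by have /asboolP[] := character_funP h. Qed.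

Lemma dual_continuous (h : D) : continuous h.
Proof. by have /asboolP[] := character_funP h. Qed.

Lemma dualD (h k : D) g : (h + k) g = h g + k g.
Proof. by []. Qed.

Lemma dual_two_torsion (h : D) : h + h = 0.
Proof.
apply/val_inj/funext => g /=; rewrite -[LHS]/(h g + h g) -dual_additive X2.
by apply: (addrI (h 0)); rewrite -dual_additive !addr0.
Qed.

Lemma dual_bool_hom (h : D) : bool_hom (fun g => h g != 0).
Proof. by have [] := additive_circle_bool_hom X2 (dual_additive h). Qed.

Lemma dual_sign (h : D) g : h g = circle_sign R (h g != 0).
Proof. by have [_] := additive_circle_bool_hom X2 (dual_additive h). Qed.

Lemma dual_eval_bool_hom g : bool_hom (fun k : D => k g != 0).
Proof.
move=> k l; rewrite -(circle_sign_neq0 R (_ (+) _)) circle_signD -!dual_sign.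
by rewrite dualD.
Qed.

(** Characters have only two values, so equality at [g] means avoiding the other value [m], a
    subbasic open condition for the compact set consisting of [g]. *)
Lemma dual_agree_nbhs (h : D) (g : X) : nbhs h [set k : D | k g = h g].
Proof.
pose m := circle_sign R (h g == 0).
have mP (k : D) : k g != m <-> k g = h g.
  have hE := dual_sign h g; have kE := dual_sign k g.
  rewrite /m -[h g == 0]negbK; move: hE kE.
  set a := h g != 0; set b := k g != 0 => -> ->.
  rewrite (inj_eq (@circle_sign_inj R)).
  by case: a; case: b; split=> // /circle_sign_inj.
have oS : open ([set k | k @` [set g] `<=` [set w | w != m]] :
    set {compact-open, X -> circle R}).
  by apply: compact_open_open; [exact: compact_set1|exact: circle_punctured_open].
have : nbhs h [set k : D | character_fun k @` [set g] `<=` [set w | w != m]].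
  apply: open_nbhs_nbhs; split; first by exists
    [set k | k @` [set g] `<=` [set w | w != m]].
  by move=> _ [_ -> <-]; apply/mP.
by apply: filterS => k km; apply/mP; apply: km; exists g.
Qed.

Lemma dual_kernel_nbhs (h : D) : nbhs (0 : X) [set g | (h g != 0) = false].
Proof.
have h0 : h 0 = 0 by apply: (addrI (h 0)); rewrite -dual_additive !addr0.
have : nbhs (h 0) [set w | w != circle_sign R true].
  apply: open_nbhs_nbhs; split; first exact: circle_punctured_open.
  by rewrite /mkset h0 eq_sym circle_sign_neq0.
have ch : continuous h by exact: dual_continuous.
move=> /ch; apply: (@filterS _ _ _ (h @^-1` [set w | w != circle_sign R true])) => g.
by rewrite /preimage /mkset dual_sign; case: (h g != 0); rewrite ?eqxx.
Qed.

Hypothesis X_compact_finite : forall K : set X, compact K -> finite_set K.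

(** As compact sets are finite, the compact-open topology is that of pointwise convergence, and
    pointwise convergence of two-valued functions is eventual equality at each point. *)
Lemma dual_nbhs (h : D) (V : set D) :
  nbhs h V <-> exists s : seq X, forall k : D, (forall g, g \in s -> k g = h g) -> V k.
Proof.
split=> [|[s sV]]; last first.
  have : nbhs h [set k : D | forall g, g \in s -> k g = h g].
    elim: s {sV} => [|g s IH]; first by apply: filterS filterT => k _ g.
    apply: filterS (filterI (dual_agree_nbhs h g) IH) => k [kg ks] g'.
    by rewrite inE => /predU1P[->//|/ks].
  by apply: filterS => k /sV.
pose F : set_system {compact-open, X -> circle R} :=
  filter_from setT (fun s : seq X => [set k | forall g, g \in s -> k g = h g]).
have FF : Filter F.
  apply: filter_from_filter; first by exists [::].
  move=> s t _ _; exists (s ++ t) => // k kst; split=> g gs; apply: kst.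
    by rewrite mem_cat gs.
  by rewrite mem_cat gs orbT.
have Fh : F --> (character_fun h : {compact-open, X -> circle R}).
  apply/compact_open_cvgP => K W cK oW hKW.
  have /finite_seqP[s sK] := X_compact_finite cK; exists s => // k ks _ [g Kg <-].
  have gs : g \in s by move: Kg; rewrite sK.
  by rewrite (ks _ gs); apply: hKW; exists g.
rewrite nbhsE => -[W [[W' oW' <-] W'h] WV].
have [s _ sW'] := Fh W' (open_nbhs_nbhs (conj oW' W'h)).
by exists s => k ks; apply: WV; apply: sW'.
Qed.

End dual.

Section reflexivity.
Variables (R : realType) (G : zmodType) (J : choiceType) (chi : J -> G -> bool).
Hypothesis chih : forall j, bool_hom (chi j).
Hypothesis G2 : forall x : G, x + x = 0.
Hypothesis Ginf : infinite_set [set: G].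
Hypothesis row : forall (j : nat -> J) f, exists g, forall n, chi (j n) g = f (j n).
Hypothesis col : forall (phi : G -> bool) (x : nat -> G), bool_hom phi ->
  exists j, forall n, chi j (x n) = phi (x n).

Local Notation X := (with_topology (character_topology chih)).
Local Notation D := (pontryagin_dual R X).

Let X2 : forall x : X, x + x = 0. Proof. exact: G2. Qed.

Fact chi_character_subproof (j : J) :
  (fun g => circle_sign R (chi j g)) \in @is_character R X.
Proof.
apply/asboolP; split=> [x V /nbhs_singleton Vx|x y]; last by rewrite chih circle_signD.
by apply: filterS (agree_nbhs [:: j] x) => y /(_ j (mem_head _ _)) yx; rewrite /= yx.
Qed.

Definition chi_character (j : J) : D := Character (chi_character_subproof j).

Lemma chi_characterE j g : (chi_character j g != 0) = chi j g.
Proof. exact: circle_sign_neq0. Qed.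

(** The kernel of [h] is a neighbourhood of 0, so it contains the common kernel of finitely many
    [chi j]. *)
Lemma dual_span (h : D) : exists s : seq J, h = \sum_(j <- s) chi_character j.
Proof.
have /character_nbhs[s sP] := dual_kernel_nbhs X2 h.
have [|t tP] := hom_finite_kernel (s := s) chih (dual_bool_hom X2 h).
  move=> g sg; apply: sP => j js; rewrite (bool_hom0 (chih j)).
  by apply/negbTE; exact: (allP sg).
exists t; apply/val_inj/funext => g; rewrite /= (dual_sign X2 h) tP.
elim: t {tP} => [|j t IH]; first by rewrite !big_nil.
by rewrite !big_cons circle_signD IH.
Qed.

(** Some [g] realises the values of [phi] on the countably many [chi_character j] that occur in
    expansions of [y] and the [x n]. Evaluation at [g] then agrees with [phi] at these points and is
    locally constant. *)
Lemma dual_hom_local : hom_local D.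
Proof.
move=> phi phih x y.
have /choice[s sP] n := dual_span (x n).
have [t tP] := dual_span y.
have [j0 _] := col (fun=> 0 : G) (phi := fun=> false) (fun _ _ => erefl).
have [g gP] := character_interpolation row j0 (fun n => if n is m.+1 then s m else t)
  (fun j => phi (chi_character j)).
have span_eval (u : seq J) : (forall j, j \in u -> chi j g = phi (chi_character j)) ->
    ((\sum_(j <- u) chi_character j : D) g != 0) = phi (\sum_(j <- u) chi_character j).
  move=> ug; rewrite (bool_hom_sum u chi_character phih).
  rewrite (bool_hom_sum u chi_character (dual_eval_bool_hom X2 g)).
  by apply: eq_big_seq => j /ug <-; exact: chi_characterE.
exists [set k : D | k g = y g]; first exact: (dual_agree_nbhs X2).
move=> n /= xy; rewrite sP tP -!span_eval -?sP -?tP ?xy //.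
- by move=> j js; apply: (gP 0%N).
- by move=> j js; apply: (gP n.+1).
Qed.

Lemma character_reflexive : pontryagin_reflexive R X.
Proof.
have D2 : forall h : D, h + h = 0 by move=> h; exact: dual_two_torsion.
have Xfin (K : set X) : compact K -> finite_set K by exact: character_compact_finite.
have Dfin (K : set D) : compact K -> finite_set K.
  by apply: hom_local_compact_finite => //; exact: dual_hom_local.
(* [Phi] vanishes on the common kernel of finitely many evaluations, so it is a sum of evaluations,
   which is the evaluation at the sum of the points. *)
have surj (Phi : pontryagin_dual R D) : exists g : X, bidual_map R g = Phi.
  have /(dual_nbhs X2 Xfin)[s sP] := dual_kernel_nbhs D2 Phi.
  have [||t tP] := hom_finite_kernel (G := D) (chi := fun (g : X) (k : D) => k g != 0)
      (s := s) _ (dual_bool_hom D2 Phi).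
  - exact: dual_eval_bool_hom.
  - move=> k ks; apply: sP => g gs; apply/eqP/negPn.
    exact: (allP ks).
  exists (\sum_(g <- t) g); apply/val_inj/funext => k /=.
  rewrite (dual_sign D2 Phi k) tP (dual_sign X2 k).
  by rewrite (bool_hom_sum t id (dual_bool_hom X2 k)).
have inj : injective (@bidual_map R X).
  move=> g g' e; apply/eqP/negPn/negP => /(character_separates chih G2 col)[j /eqP]; apply.
  have := congr1 (fun P => character_fun P (chi_character j)) e.
  by rewrite -!chi_characterE => /= ->.
have [inv invP] := choice surj.
split.
  by move=> x y; apply/val_inj/funext => k /=; exact: dual_additive.
exists inv; split=> //.
- by move=> g; apply: inj; rewrite invP.
(* Continuity of [bidual_map]: a neighbourhood in the bidual tests finitely many [k], and each [k]
   is a finite sum of the defining characters. *)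
- move=> g V /(dual_nbhs D2 Dfin)[s sV].
  apply: (@filterS _ _ _ [set g' : X | forall k : D, k \in s -> k g' = k g]).
    by move=> g' g'P; apply: sV => k ks; exact: g'P.
  elim: s {sV} => [|k s IH]; first by apply: filterS filterT => g' _ k.
  have [u ku] := dual_span k.
  have kg : nbhs g [set g' : X | k g' = k g].
    apply/character_nbhs; exists u => g' ug' /=.
    rewrite (dual_sign X2 k g') (dual_sign X2 k g) ku.
    rewrite !(bool_hom_sum u chi_character (dual_eval_bool_hom X2 _)).
    congr (circle_sign R _).
    by apply: eq_big_seq => j ju; rewrite !chi_characterE ug'.
  apply: filterS (filterI kg IH) => g' [k1 k2] l; rewrite inE.
  by move=> /predU1P[->//|/k2].
(* Continuity of the inverse: the finitely many [chi j] that define a neighbourhood in the group are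
   themselves test points in the dual. *)
- move=> Phi V /character_nbhs[s sV]; apply/(dual_nbhs D2 Dfin).
  exists [seq chi_character j | j <- s] => Psi PsiPhi; apply: sV => j js.
  rewrite -!chi_characterE.
  have := PsiPhi (chi_character j) (map_f _ js).
  by rewrite -{1}(invP Psi) -{1}(invP Phi) /= => ->.
Qed.

End reflexivity.

Unset Implicit Arguments.

Theorem corollary5p4 (R : realType) (G : topologicalZmodType)
    (G_hausdorff : hausdorff_space G)
    (G_infinite : infinite_set [set: G])
    (G_pseudocompact : pseudocompact R G)
    (G_boolean : forall x : G, x + x = 0)
    (G_small_or_SCH : ([set: G] #<= [set: set (set R)]) \/ SCH) :
  exists tau : group_topology G,
    [/\ hausdorff_space (with_topology tau),
        pseudocompact R (with_topology tau),
        pontryagin_reflexive R (with_topology tau)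
      & ~ selectively_pseudocompact (with_topology tau)].
Proof.
have [T [nT TG GT]] := pseudocompact_group_exponent G_hausdorff G_infinite
  G_pseudocompact G_small_or_SCH.
have [J [chi [chih row col]]] := boolean_characters G_boolean nT TG GT.
(* Interpolating the zero homomorphism shows that [J] is nonempty. *)
have [j0 _] := col (fun=> false) (fun=> 0) (fun _ _ => erefl).
exists (character_topology chih); split.
- exact: character_hausdorff.
- exact: character_pseudocompact.
- exact: character_reflexive.
- exact: character_not_selectively_pseudocompact.
Qed.
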